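(* For every pair of integers $r \geq -1$, $L \geq 0$, we have $$\mathbf{Poly}_{1}(r,L) = \big\{ V \text{ an } \mathbf{FI}\text{-module} : \delta(V) \leq r \text{ and } h^{\max}(V) \leq L-1 \big\}.$$
   Context: $\mathbf{FI}$ is the category of finite sets and injections. An $\mathbf{FI}$-module is a functor $V$ from $\mathbf{FI}$ to the category of $\mathbb{Z}$-modules; $V_S$ is its value at a finite set $S$ and $V_\alpha : V_S \to V_T$ the map induced by an injection $\alpha : S \hookrightarrow T$. $\mathbf{FI}$-modules form an abelian category with kernels and cokernels computed pointwise. Degree: $\deg(W) := \min\{d \geq -1 : W_S = 0 \text{ for all finite } S \text{ with } |S| > d\} \in \{-1,0,1,\dots\}\cup\{\infty\}$ (with $\deg(W)=\infty$ if no such $d$ exists). Torsion: $V$ is torsion if for every finite set $S$ and $x \in V_S$ there is an injection $\alpha : S \hookrightarrow T$ of finite sets with $V_\alpha(x) = 0$. $\mathrm{H}^0_{\mathfrak m}$ is the functor on $\mathbf{FI}$-modules assigning to $V$ its largest torsion $\mathbf{FI}$-submodule; it is left exact, and $\mathrm{H}^j_{\mathfrak m}$ ($j\ge 0$) is its $j$-th right derived functor. Set $h^j(V) := \deg(\mathrm{H}^j_{\mathfrak m}(V))$ and $h^{\max}(V) := \max\{h^j(V) : j \geq 0\} \in \{-1,0,1,\dots\}\cup\{\infty\}$ (the local degree; $\infty$ if the $h^j(V)$ are unbounded). Shift and derivative: $\mathbf{\Sigma} V$ is the composition of $-\sqcup\{*\} : \mathbf{FI} \to \mathbf{FI}$ with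 $V$; the inclusions $S \hookrightarrow S\sqcup\{*\}$ give a natural map $V \to \mathbf{\Sigma} V$, and $\mathbf{\Delta} V := \operatorname{coker}(V \to \mathbf{\Sigma} V)$. Stable degree: $\delta(V) := \min\{r \geq -1 : \mathbf{\Delta}^{r+1}(V) \text{ is torsion}\} \in \{-1,0,1,\dots\}\cup\{\infty\}$. The class $\mathbf{Poly}_1(r,L)$ is defined recursively for integers $r\ge -1$, $L\ge 0$: $\mathbf{Poly}_1(-1,L)$ is the class of $\mathbf{FI}$-modules $V$ with $\deg(V)\le L-1$; for $r \geq 0$, $\mathbf{Poly}_1(r,L)$ is the class of $\mathbf{FI}$-modules $V$ such that $h^0(V) \leq L-1$ and $\mathbf{\Delta} V \in \mathbf{Poly}_1(r-1,L)$. *)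

(* Defs.v *)
From HB Require Import structures.
From mathcomp Require Import all_boot all_order all_algebra.
From mathcomp Require Import ring_quotient.
From mathcomp Require Import boolp classical_sets functions constructive_ereal.

Set Implicit Arguments.
Unset Strict Implicit.
Unset Printing Implicit Defensive.

Import Order.TTheory GRing.Theory Num.Theory.
Local Open Scope ring_scope.
Local Open Scope quotient_scope.

Definition zsub_axiom (A : zmodType) (P : A -> Prop) : Prop :=
  P 0 /\ forall x y, P x -> P y -> P (x - y).

Section Zsub.
Variables (A : zmodType) (P : A -> Prop) (HP : zsub_axiom P).

Definition zsub_pred of zsub_axiom P : pred A := fun x => `[< P x >].

Lemma zsub_closed : zmod_closed (zsub_pred HP).
Proof.
case: (HP) => P0 PB; split=> [|x y /asboolP Px /asboolP Py]; apply/asboolP => //.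
exact: PB.
Qed.

HB.instance Definition _ := GRing.isZmodClosed.Build A (zsub_pred HP) zsub_closed.

Definition zsub : zmodClosed A := GRing.ZmodClosed.clone A (zsub_pred HP) _.

Lemma zsubP x : reflect (P x) (x \in zsub).
Proof. exact: asboolP. Qed.

End Zsub.

Section Subgroup.
Variables (A : zmodType) (P : zmodClosed A).

Record subg := Subg { subg_val : A; _ : subg_val \in P }.
HB.instance Definition _ := [isSub for subg_val].
HB.instance Definition _ := [Choice of subg by <:].
HB.instance Definition _ := [SubChoice_isSubZmodule of subg by <:].

Definition subg_incl : {additive subg -> A} := \val.

Lemma subg_inj : injective subg_val. Proof. exact: val_inj. Qed.

Lemma subgP (x : subg) : subg_val x \in P. Proof. exact: valP. Qed.

End Subgroup.

Section SubgroupMap.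
Variables (A B : zmodType) (P : zmodClosed A) (Q : zmodClosed B).
Variables (f : {additive A -> B}) (fPQ : forall x, x \in P -> f x \in Q).

Definition subg_map_fun (x : subg P) : subg Q := Subg (fPQ (subgP x)).

Lemma subg_map_additive : zmod_morphism subg_map_fun.
Proof. by move=> x y; apply: val_inj; rewrite /= !raddfB. Qed.

HB.instance Definition _ :=
  GRing.isZmodMorphism.Build (subg P) (subg Q) subg_map_fun subg_map_additive.

Definition subg_map : {additive subg P -> subg Q} := subg_map_fun.

Definition quotg_map_fun (x : Quotient.quot P) : Quotient.quot Q :=
  \pi_(Quotient.quot Q) (f (repr x)).

Lemma quotg_eqP (C : zmodType) (R : zmodClosed C) (x y : C) :
  reflect (\pi_(Quotient.quot R) x = \pi_(Quotient.quot R) y) (x - y \in R).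
Proof. by rewrite Quotient.idealrBE; apply: eqP. Qed.

Lemma quotg_eq0 (C : zmodType) (R : zmodClosed C) (x : C) :
  reflect (\pi_(Quotient.quot R) x = 0) (x \in R).
Proof.
by rewrite -[x in x \in R]subr0 -(raddf0 \pi_(Quotient.quot R)); apply: quotg_eqP.
Qed.

Lemma quotg_map_pi (x : A) :
  quotg_map_fun (\pi_(Quotient.quot P) x) = \pi_(Quotient.quot Q) (f x).
Proof.
apply/quotg_eqP; rewrite -raddfB; apply: fPQ; apply/quotg_eqP.
by rewrite reprK.
Qed.

Lemma quotg_map_additive : zmod_morphism quotg_map_fun.
Proof.
move=> x y; rewrite -[x]reprK -[y]reprK -raddfB !quotg_map_pi.
by rewrite raddfB raddfB.
Qed.

HB.instance Definition _ :=
  GRing.isZmodMorphism.Build (Quotient.quot P) (Quotient.quot Q)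
    quotg_map_fun quotg_map_additive.

Definition quotg_map : {additive Quotient.quot P -> Quotient.quot Q} :=
  quotg_map_fun.

End SubgroupMap.

Definition FIhom (S T : finType) := {f : {ffun S -> T} | injectiveb f}.

Definition FIfun (S T : finType) (f : FIhom S T) : S -> T := val f.
Coercion FIfun : FIhom >-> Funclass.

Lemma FIhom_inj S T (f : FIhom S T) : injective f.
Proof. by apply/injectiveP; case: f. Qed.

Definition mkFIhom (S T : finType) (f : S -> T) (injf : injective f) : FIhom S T :=
  exist _ [ffun x => f x]
    (introT (injectiveP _) (eq_inj injf (fun x => esym (ffunE f x)))).

Lemma mkFIhomE (S T : finType) (f : S -> T) (injf : injective f) x : mkFIhom injf x = f x.
Proof. by rewrite /FIfun /= ffunE. Qed.

Lemma FIhomP S T (f g : FIhom S T) : f =1 g -> f = g.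
Proof. by move=> fg; apply: val_inj; apply/ffunP. Qed.

Definition FIid (S : finType) : FIhom S S := mkFIhom (@inj_id S).

Definition FIcomp (S T U : finType) (g : FIhom T U) (f : FIhom S T) : FIhom S U :=
  mkFIhom (inj_comp (@FIhom_inj _ _ g) (@FIhom_inj _ _ f)).

Lemma FIidE S x : FIid S x = x. Proof. exact: mkFIhomE. Qed.

Lemma FIcompE S T U (g : FIhom T U) (f : FIhom S T) x : FIcomp g f x = g (f x).
Proof. exact: mkFIhomE. Qed.

(* A Z-module is a [zmodType]; its choice structure is no restriction under the
   classical axioms. *)
Record FImod := MkFImod {
  FIobj :> finType -> zmodType;
  FImap : forall S T : finType, FIhom S T -> {additive FIobj S -> FIobj T};
  FImap_id : forall (S : finType) (x : FIobj S), FImap (FIid S) x = x;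
  FImap_comp : forall (S T U : finType) (g : FIhom T U) (f : FIhom S T)
    (x : FIobj S), FImap (FIcomp g f) x = FImap g (FImap f x)
}.

Record FImor (V W : FImod) := MkFImor {
  FImor_fun :> forall S : finType, {additive V S -> W S};
  FImor_nat : forall (S T : finType) (f : FIhom S T) (x : V S),
    FImor_fun T (FImap V f x) = FImap W f (FImor_fun S x)
}.

Record FIsub (V : FImod) := MkFIsub {
  FIsub_mem :> forall S : finType, zmodClosed (V S);
  FIsub_map : forall (S T : finType) (f : FIhom S T) (x : V S),
    x \in FIsub_mem S -> FImap V f x \in FIsub_mem T
}.

Section SubQuotientModules.
Variables (V : FImod) (U : FIsub V).

Definition submod_map S T (f : FIhom S T) : {additive subg (U S) -> subg (U T)} :=
  subg_map (fun x Ux => FIsub_map f Ux).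

Lemma submod_map_id S x : submod_map (FIid S) x = x.
Proof. by apply: val_inj; rewrite /= FImap_id. Qed.

Lemma submod_map_comp S T R (g : FIhom T R) (f : FIhom S T) x :
  submod_map (FIcomp g f) x = submod_map g (submod_map f x).
Proof. by apply: val_inj; rewrite /= FImap_comp. Qed.

Definition submod : FImod := MkFImod submod_map_id submod_map_comp.

Definition submod_incl : FImor submod V :=
  @MkFImor submod V (fun S => subg_incl (U S)) (fun S T f x => erefl).

Definition quotmod_map S T (f : FIhom S T) :
    {additive Quotient.quot (U S) -> Quotient.quot (U T)} :=
  quotg_map (fun x Ux => FIsub_map f Ux).

Lemma quotmod_map_pi S T (f : FIhom S T) (x : V S) :
  quotmod_map f (\pi_(Quotient.quot (U S)) x) =
  \pi_(Quotient.quot (U T)) (FImap V f x).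
Proof. exact: (quotg_map_pi (fun x Ux => FIsub_map f Ux)). Qed.

Lemma quotmod_map_id S x : quotmod_map (FIid S) x = x.
Proof.
by rewrite -[x]reprK quotmod_map_pi FImap_id.
Qed.

Lemma quotmod_map_comp S T R (g : FIhom T R) (f : FIhom S T) x :
  quotmod_map (FIcomp g f) x = quotmod_map g (quotmod_map f x).
Proof.
by rewrite -[x]reprK !quotmod_map_pi FImap_comp reprK.
Qed.

Definition quotmod : FImod := MkFImod quotmod_map_id quotmod_map_comp.

Definition quotmod_proj_fun S : {additive V S -> quotmod S} :=
  \pi_(Quotient.quot (U S)).

Lemma quotmod_proj_nat S T (f : FIhom S T) (x : V S) :
  quotmod_proj_fun T (FImap V f x) = FImap quotmod f (quotmod_proj_fun S x).
Proof. exact: esym (quotmod_map_pi _ _). Qed.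

Definition quotmod_proj : FImor V quotmod := MkFImor quotmod_proj_nat.

End SubQuotientModules.

Section KernelImage.
Variables (V W : FImod) (f : FImor V W).

Lemma ker_zsub S : zsub_axiom (fun x : V S => f S x = 0).
Proof. by split=> [|x y x0 y0]; rewrite ?raddf0 // raddfB x0 y0 subr0. Qed.

Lemma ker_map S T (g : FIhom S T) (x : V S) :
  x \in zsub (ker_zsub S) -> FImap V g x \in zsub (ker_zsub T).
Proof. by move=> /zsubP x0; apply/zsubP; rewrite FImor_nat x0 raddf0. Qed.

Definition FIker : FIsub V := MkFIsub ker_map.

Lemma im_zsub S : zsub_axiom (fun y : W S => exists x : V S, f S x = y).
Proof.
split=> [|_ _ [x <-] [x' <-]]; first by exists 0; rewrite raddf0.
by exists (x - x'); rewrite raddfB.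
Qed.

Lemma im_map S T (g : FIhom S T) (y : W S) :
  y \in zsub (im_zsub S) -> FImap W g y \in zsub (im_zsub T).
Proof.
by move=> /zsubP[x <-]; apply/zsubP; exists (FImap V g x); rewrite FImor_nat.
Qed.

Definition FIim : FIsub W := MkFIsub im_map.

Definition FIcoker : FImod := quotmod FIim.

Definition FIcoker_proj : FImor W FIcoker := quotmod_proj FIim.

End KernelImage.

Section Compose.
Variables (U V W : FImod) (g : FImor V W) (f : FImor U V).

Definition FImor_comp_fun S : {additive U S -> W S} := g S \o f S.

Lemma FImor_comp_nat S T (h : FIhom S T) (x : U S) :
  FImor_comp_fun T (FImap U h x) = FImap W h (FImor_comp_fun S x).
Proof. by rewrite /= !FImor_nat. Qed.

Definition FImor_comp : FImor U W := MkFImor FImor_comp_nat.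

End Compose.

Definition FImono (V W : FImod) (f : FImor V W) : Prop :=
  forall S, injective (f S).

Definition torsion (V : FImod) : Prop :=
  forall (S : finType) (x : V S),
    exists (T : finType) (f : FIhom S T), FImap V f x = 0.

Lemma FI_amalg (S T U : finType) (f : FIhom S T) (g : FIhom S U) :
  exists (W : finType) (f' : FIhom T W) (g' : FIhom U W),
    FIcomp f' f = FIcomp g' g.
Proof.
pose g1 (u : U) : option S := [pick s | g s == u].
pose h (u : U) : T + U := if g1 u is Some s then inl (f s) else inr u.
have g1K s : g1 (g s) = Some s.
  rewrite /g1; case: pickP => [s' /eqP /FIhom_inj -> //|/(_ s)].
  by rewrite eqxx.
have g1E u s : g1 u = Some s -> u = g s.
  by rewrite /g1; case: pickP => // s' /eqP <- [<-].
have injh : injective h.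
  move=> u u'; rewrite /h.
  case E: (g1 u) => [s|]; case E': (g1 u') => [s'|] //; last by case.
  by case=> /FIhom_inj ss; rewrite (g1E _ _ E) (g1E _ _ E') ss.
have injl : injective (@inl T U) by move=> x y [].
exists (T + U)%type, (mkFIhom injl), (mkFIhom injh).
by apply: FIhomP => s; rewrite !FIcompE !mkFIhomE /h g1K.
Qed.

Section TorsionPart.
Variable V : FImod.

Definition is_torsion_elt S (x : V S) : Prop :=
  exists (T : finType) (f : FIhom S T), FImap V f x = 0.

Lemma torsion_zsub S : zsub_axiom (@is_torsion_elt S).
Proof.
split=> [|x y [T [f fx]] [U [g gy]]].
  by exists S, (FIid S); rewrite raddf0.
have [W [f' [g' fg]]] := FI_amalg f g.
exists W, (FIcomp f' f).
by rewrite raddfB {2}fg !FImap_comp fx gy !raddf0 addr0.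
Qed.

Lemma torsion_map S T (h : FIhom S T) (x : V S) :
  x \in zsub (torsion_zsub S) -> FImap V h x \in zsub (torsion_zsub T).
Proof.
move=> /zsubP[U [g gx]]; apply/zsubP.
have [W [f' [g' fg]]] := FI_amalg h g.
by exists W, f'; rewrite -FImap_comp fg FImap_comp gx raddf0.
Qed.

Definition torsion_part : FIsub V := MkFIsub torsion_map.

Lemma torsion_part_torsion : torsion (submod torsion_part).
Proof.
move=> S [x Ux]; have /zsubP[T [f fx]] := Ux.
by exists T, f; apply: val_inj.
Qed.

Lemma torsion_part_largest (U : FIsub V) : torsion (submod U) ->
  forall S (x : V S), x \in U S -> x \in torsion_part S.
Proof.
move=> tU S x Ux; apply/zsubP; have [T [f /(congr1 val) fx]] := tU S (Subg Ux).
by exists T, f.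
Qed.

End TorsionPart.

(* [Gam] is the functor H^0_m: by [torsion_part_torsion] and
   [torsion_part_largest], [torsion_part V] is the largest torsion submodule. *)
Definition Gam (V : FImod) : FImod := submod (torsion_part V).

Section GamMap.
Variables (V W : FImod) (f : FImor V W).

Lemma Gam_mem S (x : V S) : x \in torsion_part V S -> f S x \in torsion_part W S.
Proof.
move=> /zsubP[T [g gx]]; apply/zsubP.
by exists T, g; rewrite -FImor_nat gx raddf0.
Qed.

Definition Gam_map_fun S : {additive Gam V S -> Gam W S} :=
  subg_map (@Gam_mem S).

Lemma Gam_map_nat S T (g : FIhom S T) (x : Gam V S) :
  Gam_map_fun T (FImap (Gam V) g x) = FImap (Gam W) g (Gam_map_fun S x).
Proof. by apply: val_inj; rewrite /= FImor_nat. Qed.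

Definition Gam_map : FImor (Gam V) (Gam W) := MkFImor Gam_map_nat.

End GamMap.

Definition injective_mod (I : FImod) : Prop :=
  forall (A B : FImod) (i : FImor A B), FImono i ->
  forall f : FImor A I, exists g : FImor B I, forall S x, g S (i S x) = f S x.

Record injres (V : FImod) := MkInjres {
  ir_obj : nat -> FImod;
  ir_aug : FImor V (ir_obj 0);
  ir_d : forall n, FImor (ir_obj n) (ir_obj n.+1);
  ir_inj : forall n, injective_mod (ir_obj n);
  ir_aug_mono : FImono ir_aug;
  ir_exact0 : forall S (x : ir_obj 0 S),
    ir_d 0 S x = 0 <-> exists y, ir_aug S y = x;
  ir_exact : forall n S (x : ir_obj n.+1 S),
    ir_d n.+1 S x = 0 <-> exists y, ir_d n S y = x
}.

(* [boundaries g U] is the part of [U] lying in the kernel of [g], as a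
   submodule of that kernel. *)
Section Boundaries.
Variables (V W : FImod) (g : FImor V W) (U : FIsub V).

Lemma boundaries_zsub S :
  zsub_axiom (fun x : submod (FIker g) S => subg_val x \in U S).
Proof. by split=> [|x y Ux Uy]; rewrite /= ?rpred0 // rpredB. Qed.

Lemma boundaries_map S T (h : FIhom S T) (x : submod (FIker g) S) :
  x \in zsub (boundaries_zsub S) ->
  FImap (submod (FIker g)) h x \in zsub (boundaries_zsub T).
Proof. by move=> /zsubP Ux; apply/zsubP; apply: FIsub_map. Qed.

Definition boundaries : FIsub (submod (FIker g)) := MkFIsub boundaries_map.

End Boundaries.

Section ZeroSub.
Variable V : FImod.

Lemma zero_zsub S : zsub_axiom (fun x : V S => x = 0).
Proof. by split=> // x y -> ->; rewrite subr0. Qed.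

Lemma zero_map S T (h : FIhom S T) (x : V S) :
  x \in zsub (zero_zsub S) -> FImap V h x \in zsub (zero_zsub T).
Proof. by move=> /zsubP ->; apply/zsubP; rewrite raddf0. Qed.

Definition zerosub : FIsub V := MkFIsub zero_map.

End ZeroSub.

(* The j-th cohomology of 0 -> Gam I^0 -> Gam I^1 -> ... *)
Definition cohom_Gam V (R : injres V) (j : nat) : FImod :=
  quotmod (boundaries (Gam_map (ir_d R j))
    (match j return FIsub (Gam (ir_obj R j)) with
     | 0 => zerosub (Gam (ir_obj R 0))
     | i.+1 => FIim (Gam_map (ir_d R i))
     end)).

(* Baer: homomorphisms to a divisible group extend.  A partial homomorphism
   is represented by its graph. *)
Section DivisibleExtension.
Variables (B D : zmodType).
Hypothesis divD : forall n (d : D), (0 < n)%N -> exists e, e *+ n = d.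

Local Open Scope classical_set_scope.

Definition sub_closed (G : set (B * D)) :=
  forall x y, G x -> G y -> G (x - y).
Definition functional (G : set (B * D)) := forall d, G (0, d) -> d = 0.

Variable G0 : set (B * D).
Hypotheses (G00 : G0 (0, 0)) (G0B : sub_closed G0) (G0f : functional G0).

Let P (G : set (B * D)) :=
  [/\ sub_closed G, functional G & forall x, G x -> G0 `<=` G].

Lemma div_maximal_graph : exists G : set (B * D),
  [/\ sub_closed G, functional G, G0 `<=` G &
      forall G', G `<` G' -> ~ [/\ sub_closed G', functional G' & G0 `<=` G']].
Proof.
have [|G [[GB Gf G0G] Gmax]] := @Zorn_bigcup (B * D)%type P.
  move=> F FP Ftot; split.
  - move=> x y [X FX Xx] [Y FY Yy].
    have [XY|YX] := Ftot _ _ FX FY.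
      by exists Y => //; have [YB _ _] := FP _ FY; apply: YB => //; apply: XY.
    by exists X => //; have [XB _ _] := FP _ FX; apply: XB => //; apply: YX.
  - by move=> d [X FX Xd]; have [_ Xf _] := FP _ FX; apply: Xf.
  - move=> x [X FX Xx] y G0y; exists X => //.
    by have [_ _ X0] := FP _ FX; apply: (X0 _ Xx).
have G0sub : G0 `<=` G.
  have [[x Gx]|nG] := pselect (exists x, G x); first exact: G0G Gx.
  exfalso; apply: (Gmax G0); last by split=> // x _ y.
  split; last by move=> G0G'; apply: nG; exists (0, 0); apply: G0G'.
  by move=> x Gx; case: nG; exists x.
exists G; split=> // G' GG' [G'B G'f G0G']; apply: (Gmax _ GG').
by split=> // x _.
Qed.

Section Maximal.
Variable G : set (B * D).
Hypotheses (GB : sub_closed G) (Gf : functional G) (G0G : G0 `<=` G).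
Hypothesis Gmax : forall G', G `<` G' ->
  ~ [/\ sub_closed G', functional G' & G0 `<=` G'].

Let Gz : G (0, 0). Proof. exact: G0G. Qed.
Let GN x : G x -> G (- x).
Proof. by move=> Gx; rewrite -[- x]add0r; apply: GB. Qed.
Let GD x y : G x -> G y -> G (x + y).
Proof. by move=> Gx Gy; rewrite -[y]opprK; apply: GB => //; apply: GN. Qed.
Let GMn x y n : G (x, y) -> G (x *+ n, y *+ n).
Proof.
by move=> Gx; elim: n => [|n IH]; rewrite ?mulr0n // !mulrS; exact: GD Gx IH.
Qed.
Let GMz x y (z : int) : G (x, y) -> G (x *~ z, y *~ z).
Proof.
case: z => n Gx; first exact: GMn.
by rewrite NegzE !mulrNz; exact: GN (GMn n.+1 Gx).
Qed.

(* A value for [b] compatible with all the multiples of [b] in the domain. *)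
Let compat (b : B) : exists d : D,
  forall z : int, (exists e, G (b *~ z, e)) -> G (b *~ z, d *~ z).
Proof.
pose Q n := `[< (0 < n)%N /\ exists e, G (b *+ n, e) >].
have [exQ|nQ] := pselect (exists n, Q n); last first.
  exists 0 => z [e Ge]; suff -> : z = 0 by rewrite !mulr0z.
  apply: contrapT => /eqP z0; apply: nQ; exists `|z|%N; apply/asboolP.
  split; first by rewrite absz_gt0.
  case: z z0 Ge => n z0 Ge; first by exists e.
  exists (- e); rewrite -[b *+ _]opprK; apply: (GN (x := (_, _))).
  by move: Ge; rewrite NegzE mulrNz.
case: (ex_minnP exQ) => k /asboolP[k0 [e Ge]] kmin.
have [d de] := divD e k0; exists d => z [e' Ge'].
have kz : (z = (z %/ k)%Z * k + (z %% k)%Z) by exact: divz_eq.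
have zk0 : (z %% k)%Z = 0.
  have := @modz_ge0 z k; have := @ltz_pmod z k.
  rewrite !ltz_nat k0 => /(_ isT) rk /(_ (lt0n_neq0 k0)) r0.
  move: r0 rk kz; case: (z %% k)%Z => // r _ rk kz.
  apply/eqP; rewrite eqz_nat; apply: contraLR rk; rewrite -lt0n => r0.
  rewrite ltz_nat -leqNgt; apply: kmin; apply/asboolP; split=> //.
  exists (e' - e *~ (z %/ k)%Z).
  have -> : b *+ r = b *~ z - (b *+ k) *~ (z %/ k)%Z.
    have -> : b *~ z = (b *+ k) *~ (z %/ k)%Z + b *+ r.
      by rewrite [in LHS]kz mulrzDr mulrC mulrzA.
    by rewrite addrAC subrr add0r.
  exact: (GB (x := (_, _)) (y := (_, _)) Ge' (GMz _ Ge)).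
rewrite kz zk0 addr0 mulrC !mulrzA.
have -> : d *~ k = e by rewrite -de.
exact: (GMz _ Ge).
Qed.

Lemma div_total (b : B) : exists d, G (b, d).
Proof.
apply: contrapT => nb; have [d dP] := compat b.
pose G' : set (B * D) := fun x => exists2 z : int, True & G (x - (b *~ z, d *~ z)).
apply: (Gmax (G' := G')).
  split.
    move=> x Gx; exists 0 => //; rewrite !mulr0z.
    by have -> : (0, 0) = 0 :> B * D by []; rewrite subr0.
  move=> G'G; apply: nb; exists d; apply: G'G; exists 1 => //.
  by rewrite !mulr1z subrr.
split.
- move=> x y [z _ Gx] [w _ Gy]; exists (z - w) => //.
  rewrite [X in G X](_ : _ = (x - (b *~ z, d *~ z)) - (y - (b *~ w, d *~ w))).
    exact: GB.
  rewrite !mulrzBr; case: x y {Gx Gy} => [x1 x2] [y1 y2].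
  by congr pair; rewrite /= !opprD !opprK addrACA.
- move=> e [z _ Gz'].
  have Ge : G (- (b *~ z), e - d *~ z).
    by rewrite -[- (b *~ z)]add0r.
  have Gz2 : G (b *~ z, d *~ z).
    apply: dP; exists (- (e - d *~ z)).
    by rewrite -[b *~ z]opprK; exact: (GN Ge).
  apply: Gf; have := GD Ge Gz2; rewrite [X in G X](_ : _ = (0, e)) //.
  by congr pair; rewrite /= ?addNr ?subrK.
- move=> x /G0G Gx; exists 0 => //; rewrite !mulr0z.
  by have -> : (0, 0) = 0 :> B * D by []; rewrite subr0.
Qed.

End Maximal.

Lemma div_extension :
  exists g : {additive B -> D}, forall b d, G0 (b, d) -> g b = d.
Proof.
have [G [GB Gf G0G Gmax]] := div_maximal_graph.
have tot := div_total GB Gf G0G Gmax.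
pose g b := projT1 (cid (tot b)).
have gP b : G (b, g b) by exact: projT2 (cid (tot b)).
have uniqG b d d' : G (b, d) -> G (b, d') -> d = d'.
  move=> Gd Gd'; apply/eqP; rewrite -subr_eq0; apply/eqP; apply: Gf.
  by rewrite -(subrr b); exact: GB Gd Gd'.
have gB : zmod_morphism g.
  by move=> x y; apply: (uniqG (x - y)) => //; exact: GB (gP x) (gP y).
exists (HB.pack_for {additive B -> D} g (GRing.isZmodMorphism.Build B D g gB)).
by move=> b d /G0G; exact: uniqG.
Qed.

End DivisibleExtension.

Lemma int_zsub : zsub_axiom (fun q : rat => q \is a Num.int).
Proof. by split=> [|x y]; [exact: rpred0 | exact: rpredB]. Qed.

Definition QZ : zmodType := Quotient.quot (zsub int_zsub).

Definition QZpi : {additive rat -> QZ} := \pi_(Quotient.quot (zsub int_zsub)).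

Lemma QZpi_eq0 q : QZpi q = 0 <-> q \is a Num.int.
Proof.
by split=> [/quotg_eq0/zsubP // | qint]; apply/quotg_eq0/zsubP.
Qed.

Lemma QZ_div n (d : QZ) : (0 < n)%N -> exists e, e *+ n = d.
Proof.
move=> n0; exists (QZpi (repr d / n%:R)).
rewrite -raddfMn /= -[_ *+ n]mulr_natr divfK ?pnatr_eq0 -?lt0n //.
by rewrite /QZpi /= reprK.
Qed.

Lemma QZ_injective (A B : zmodType) (i : {additive A -> B}) (f : {additive A -> QZ}) :
  injective i -> exists g : {additive B -> QZ}, forall a, g (i a) = f a.
Proof.
move=> inji.
pose G0 : set (B * QZ) := fun x => exists a, x = (i a, f a).
have [|x y [a ->] [a' ->]|d [a [/esym ia ->]]|g gP] := @div_extension B QZ QZ_div G0.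
- by exists 0; rewrite !raddf0.
- by exists (a - a'); rewrite !raddfB.
- by have -> : a = 0; [apply: inji; rewrite ia raddf0 | rewrite raddf0].
- by exists g => a; apply: gP; exists a.
Qed.

Lemma QZ_cogen (A : zmodType) (a : A) :
  a <> 0 -> exists g : {additive A -> QZ}, g a <> 0.
Proof.
move=> a0.
suff [c c0 cP] : exists2 c : QZ, c <> 0 & forall z : int, a *~ z = 0 -> c *~ z = 0.
  pose G0 : set (A * QZ) := fun x => exists z : int, x = (a *~ z, c *~ z).
  have [|x y [z ->] [w ->]|d [z [/esym az ->]]|g gP] := @div_extension A QZ QZ_div G0.
  - by exists 0; rewrite !mulr0z.
  - by exists (z - w); rewrite !mulrzBr.
  - exact: cP.
  - by exists g; rewrite (gP a c) //; exists 1; rewrite !mulr1z.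
have half n : (1 < n)%N -> QZpi (n%:R^-1) <> 0.
  move=> n1 /QZpi_eq0 /intrP[m mE].
  have : (m * n)%:~R = 1%:~R :> rat.
    by rewrite intrM -mE mulVf // pnatr_eq0 -lt0n; apply: leq_trans n1.
  move/intr_inj => mn; have : (n %| 1)%N.
    by have := dvdz_mull m (dvdzz n); rewrite mn.
  by rewrite dvdn1 => /eqP n1'; rewrite n1' in n1.
pose Q n := `[< (0 < n)%N /\ a *+ n = 0 >].
have [exQ|nQ] := pselect (exists n, Q n); last first.
  exists (QZpi (2%:R^-1)); first exact: half.
  move=> z az; suff -> : z = 0 by rewrite mulr0z.
  apply: contrapT => /eqP z0; apply: nQ; exists `|z|%N; apply/asboolP.
  rewrite absz_gt0; split=> //; case: z z0 az => n z0 //.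
  by rewrite NegzE mulrNz => /eqP; rewrite oppr_eq0 => /eqP.
case: (ex_minnP exQ) => k /asboolP[k0 ak] kmin.
exists (QZpi (k%:R^-1)).
  apply: half; rewrite ltn_neqAle k0 andbT; apply/eqP => k1.
  by apply: a0; rewrite -ak -k1.
move=> z az.
have kz : (z = (z %/ k)%Z * k + (z %% k)%Z) by exact: divz_eq.
have zk0 : (z %% k)%Z = 0.
  have := @modz_ge0 z k; have := @ltz_pmod z k.
  rewrite !ltz_nat k0 => /(_ isT) rk /(_ (lt0n_neq0 k0)) r0.
  move: r0 rk kz; case: (z %% k)%Z => // r _ rk kz.
  apply/eqP; rewrite eqz_nat; apply: contraLR rk; rewrite -lt0n => r0.
  rewrite ltz_nat -leqNgt; apply: kmin; apply/asboolP; split=> //.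
  move: az; rewrite kz mulrzDr mulrC mulrzA.
  by have -> : a *~ k = 0; rewrite // mul0rz add0r.
rewrite -raddfMz; apply/QZpi_eq0.
by rewrite kz zk0 addr0 mulrC mulrzA -[_ *~ k]mulrzr mulVf ?pnatr_eq0 -?lt0n.
Qed.

(* [V] embeds in the product, over n and b in Hom(V_n, Q/Z), of the injective
   FI-modules T |-> (FIhom T n -> Q/Z), whose contravariant Hom functor is
   W |-> Hom(W_n, Q/Z). *)
Section InjectiveHull.
Variable V : FImod.

Definition coind_index (T : finType) : Type :=
  {n : nat & (FIhom T 'I_n * {additive V 'I_n -> QZ})%type}.

Definition coind_obj (T : finType) : zmodType := coind_index T -> QZ.

Definition coind_pull S T (f : FIhom S T) (u : coind_index T) : coind_index S :=
  let: existT n (h, b) := u in existT _ n (FIcomp h f, b).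

Definition coind_map_fun S T (f : FIhom S T) (p : coind_obj S) : coind_obj T :=
  fun u => p (coind_pull f u).

Lemma coind_map_additive S T (f : FIhom S T) : zmod_morphism (coind_map_fun f).
Proof. by move=> p q; apply: funext. Qed.

HB.instance Definition _ S T (f : FIhom S T) :=
  GRing.isZmodMorphism.Build (coind_obj S) (coind_obj T)
    (coind_map_fun f) (coind_map_additive f).

Definition coind_map S T (f : FIhom S T) : {additive coind_obj S -> coind_obj T} :=
  coind_map_fun f.

Lemma coind_map_id S (p : coind_obj S) : coind_map (FIid S) p = p.
Proof.
apply: funext => -[n [h b]]; rewrite /= /coind_map_fun /=.
by have -> : FIcomp h (FIid S) = h by apply: FIhomP => x; rewrite FIcompE FIidE.
Qed.

Lemma coind_map_comp S T U (g : FIhom T U) (f : FIhom S T) (p : coind_obj S) :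
  coind_map (FIcomp g f) p = coind_map g (coind_map f p).
Proof.
apply: funext => -[n [h b]]; rewrite /= /coind_map_fun /=.
have -> // : FIcomp h (FIcomp g f) = FIcomp (FIcomp h g) f.
by apply: FIhomP => x; rewrite !FIcompE.
Qed.

Definition coind : FImod := MkFImod coind_map_id coind_map_comp.

Definition coind_emb_fun S (x : V S) : coind S :=
  fun u => let: existT n (h, b) := u in b (FImap V h x).

Lemma coind_emb_additive S : zmod_morphism (@coind_emb_fun S).
Proof. by move=> x y; apply: funext => -[n [h b]] /=; rewrite !raddfB. Qed.

HB.instance Definition _ S :=
  GRing.isZmodMorphism.Build (V S) (coind S) (@coind_emb_fun S)
    (@coind_emb_additive S).

Lemma coind_emb_nat S T (f : FIhom S T) (x : V S) :
  coind_emb_fun (FImap V f x) = FImap coind f (coind_emb_fun x).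
Proof.
apply: funext => -[n [h b]]; rewrite /= /coind_map_fun /=.
by rewrite FImap_comp.
Qed.

Definition coind_emb : FImor V coind :=
  @MkFImor V coind (fun S => @coind_emb_fun S) coind_emb_nat.

Lemma coind_emb_mono : FImono coind_emb.
Proof.
move=> S; apply: raddf_inj => x x0; apply: contrapT => nx.
have [g gx] : exists g : {additive V 'I_#|S| -> QZ},
    g (FImap V (mkFIhom (@enum_rank_inj S)) x) <> 0.
  apply: QZ_cogen => rx; apply: nx.
  have -> : x = FImap V (mkFIhom (@enum_val_inj S S))
                 (FImap V (mkFIhom (@enum_rank_inj S)) x).
    rewrite -FImap_comp -[LHS]FImap_id; congr (FImap V _ x).
    by apply: FIhomP => s; rewrite FIcompE FIidE !mkFIhomE enum_rankK.
  by rewrite rx raddf0.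
apply: gx.
exact: (congr1 (fun p => p (existT _ #|S| (mkFIhom (@enum_rank_inj S), g))) x0).
Qed.

Lemma coind_injective : injective_mod coind.
Proof.
move=> A B i moni f.
pose comp n (b : {additive V 'I_n -> QZ}) (a : A 'I_n) : QZ :=
  f 'I_n a (existT _ n (FIid 'I_n, b)).
have compB n b : zmod_morphism (comp n b).
  by move=> x y; rewrite /comp raddfB.
pose compA n b := HB.pack_for {additive A 'I_n -> QZ} (comp n b)
  (GRing.isZmodMorphism.Build (A 'I_n) QZ (comp n b) (compB n b)).
pose ext n b := projT1 (cid (QZ_injective (compA n b) (moni 'I_n))).
have extP n b a : ext n b (i 'I_n a) = comp n b a.
  exact: projT2 (cid (QZ_injective (compA n b) (moni 'I_n))) a.
pose g S (x : B S) : coind S :=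
  fun u => let: existT n (h, b) := u in ext n b (FImap B h x).
have gB S : zmod_morphism (g S).
  by move=> x y; apply: funext => -[n [h b]] /=; rewrite !raddfB.
pose gA S := HB.pack_for {additive B S -> coind S} (g S)
  (GRing.isZmodMorphism.Build (B S) (coind S) (g S) (gB S)).
have gN S T (h : FIhom S T) (x : B S) : gA T (FImap B h x) = FImap coind h (gA S x).
  apply: funext => -[n [k b]]; rewrite /= /coind_map_fun /=.
  by rewrite FImap_comp.
exists (MkFImor gN) => S x; apply: funext => -[n [h b]] /=.
rewrite -FImor_nat extP /comp FImor_nat /= /coind_map_fun /=.
by have -> : FIcomp (FIid 'I_n) h = h by apply: FIhomP => s; rewrite FIcompE FIidE.
Qed.

End InjectiveHull.

Section StandardResolution.
Variable V : FImod.

Fixpoint cosyzygy (n : nat) : FImod :=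
  if n is m.+1 then FIcoker (coind_emb (cosyzygy m)) else V.

Definition std_obj n : FImod := coind (cosyzygy n).

Definition std_d n : FImor (std_obj n) (std_obj n.+1) :=
  FImor_comp (coind_emb (cosyzygy n.+1)) (FIcoker_proj (coind_emb (cosyzygy n))).

Lemma std_d_eq0 n S (x : std_obj n S) :
  std_d n S x = 0 <-> exists y, coind_emb (cosyzygy n) S y = x.
Proof.
split=> [dx|[y <-]].
  suff /quotg_eq0/zsubP : FIcoker_proj (coind_emb (cosyzygy n)) S x = 0 by [].
  by apply: (@coind_emb_mono (cosyzygy n.+1) S); rewrite raddf0.
rewrite /std_d /FImor_comp /= /FImor_comp_fun /=.
have -> : FIcoker_proj (coind_emb (cosyzygy n)) S (coind_emb (cosyzygy n) S y) = 0.
  by apply/quotg_eq0/zsubP; exists y.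
by rewrite raddf0.
Qed.

Lemma std_exact n S (x : std_obj n.+1 S) :
  std_d n.+1 S x = 0 <-> exists y, std_d n S y = x.
Proof.
rewrite std_d_eq0; split=> [[z <-]|[y <-]].
  by exists (repr z); congr (coind_emb (cosyzygy n.+1) S _); exact: reprK.
by exists (FIcoker_proj (coind_emb (cosyzygy n)) S y).
Qed.

Definition std_res : injres V :=
  MkInjres (fun n => @coind_injective (cosyzygy n)) (@coind_emb_mono V)
    (std_d_eq0 (n := 0)) std_exact.

End StandardResolution.

(* The [j]-th right derived functor of [Gam], on objects. *)
Definition Hm (j : nat) (V : FImod) : FImod := cohom_Gam (std_res V) j.

(* [Gam] is left exact, so the zeroth derived functor is [Gam] itself. *)
Section LeftExact.
Variables (V : FImod) (R : injres V).

Lemma Gam_aug_cycle S (x : Gam V S) :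
  Gam_map (ir_aug R) S x \in FIker (Gam_map (ir_d R 0)) S.
Proof.
apply/zsubP/val_inj => /=; apply/ir_exact0.
by exists (subg_val x).
Qed.

Definition Gam_cohom0_fun S (x : Gam V S) : cohom_Gam R 0 S :=
  \pi_(Quotient.quot _) (Subg (Gam_aug_cycle x)).

Lemma Gam_cohom0_additive S : zmod_morphism (@Gam_cohom0_fun S).
Proof.
move=> x y; rewrite /Gam_cohom0_fun -raddfB; congr (\pi_(Quotient.quot _) _).
by apply/val_inj/val_inj; rewrite /= raddfB.
Qed.

HB.instance Definition _ S :=
  GRing.isZmodMorphism.Build (Gam V S) (cohom_Gam R 0 S) (@Gam_cohom0_fun S)
    (@Gam_cohom0_additive S).

Lemma Gam_cohom0_nat S T (f : FIhom S T) (x : Gam V S) :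
  Gam_cohom0_fun (FImap (Gam V) f x) =
  FImap (cohom_Gam R 0) f (Gam_cohom0_fun x).
Proof.
apply: esym; apply: etrans (quotmod_map_pi _ _ _) _.
congr (\pi_(Quotient.quot _) _).
by apply/val_inj/val_inj; rewrite /= FImor_nat.
Qed.

Definition Gam_cohom0 : FImor (Gam V) (cohom_Gam R 0) :=
  @MkFImor (Gam V) (cohom_Gam R 0) (fun S => @Gam_cohom0_fun S) Gam_cohom0_nat.

Lemma Gam_cohom0_bij S : bijective (Gam_cohom0 S).
Proof.
have inj0 : injective (Gam_cohom0 S).
  apply: raddf_inj => x /quotg_eq0/zsubP/zsubP /(congr1 val) /= x0.
  by apply/val_inj/(@ir_aug_mono _ R S); rewrite raddf0.
have surj y : exists x, Gam_cohom0 S x = y.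
  rewrite -[y]reprK; case: (repr y) => -[z tz] dz.
  have /ir_exact0[x xz] : ir_d R 0 S z = 0.
    by have /zsubP/(congr1 val) := dz.
  have tx : x \in torsion_part V S.
    have /zsubP[T [f fz]] := tz; apply/zsubP; exists T, f.
    by apply: (@ir_aug_mono _ R T); rewrite FImor_nat xz fz raddf0.
  exists (Subg tx); congr (\pi_(Quotient.quot _) _).
  by apply/val_inj/val_inj.
exists (fun y => projT1 (cid (surj y))) => [x|y]; last exact: projT2 (cid (surj y)).
by apply: inj0; exact: projT2 (cid (surj _)).
Qed.

End LeftExact.

(* The disjoint union of S and a point is [option S]. *)
Definition FIoption_fun (S T : finType) (f : FIhom S T) : option S -> option T :=
  omap f.

Lemma FIoption_inj S T (f : FIhom S T) : injective (FIoption_fun f).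
Proof. by move=> [x|] [y|] //= [/FIhom_inj ->]. Qed.

Definition FIoption S T (f : FIhom S T) : FIhom (option S) (option T) :=
  mkFIhom (@FIoption_inj S T f).

Lemma Some_injective (S : Type) : injective (@Some S).
Proof. by move=> x y []. Qed.

Definition FIsome (S : finType) : FIhom S (option S) :=
  mkFIhom (@Some_injective S).

Section Shift.
Variable V : FImod.

Lemma shift_id (S : finType) (x : V (option S)) : FImap V (FIoption (FIid S)) x = x.
Proof.
have -> : FIoption (FIid S) = FIid (option S); last exact: FImap_id.
by apply: FIhomP => -[s|]; rewrite FIidE mkFIhomE //= FIidE.
Qed.

Lemma shift_comp (S T U : finType) (g : FIhom T U) (f : FIhom S T) (x : V (option S)) :
  FImap V (FIoption (FIcomp g f)) x =
  FImap V (FIoption g) (FImap V (FIoption f) x).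
Proof.
rewrite -FImap_comp; congr (FImap V _ x).
by apply: FIhomP => -[s|]; rewrite FIcompE !mkFIhomE //= FIcompE.
Qed.

Definition shift : FImod :=
  @MkFImod (fun S : finType => V (option S)) (fun S T f => FImap V (FIoption f))
    shift_id shift_comp.

Lemma to_shift_nat S T (f : FIhom S T) (x : V S) :
  FImap V (FIsome T) (FImap V f x) = FImap shift f (FImap V (FIsome S) x).
Proof.
rewrite /= -!FImap_comp; congr (FImap V _ x).
by apply: FIhomP => s; rewrite !FIcompE !mkFIhomE.
Qed.

Definition to_shift : FImor V shift :=
  @MkFImor V shift (fun S => FImap V (FIsome S)) to_shift_nat.

Definition derivative : FImod := FIcoker to_shift.

End Shift.

(* The least integer [d >= -1] satisfying [P], or [+oo] if there is none. *)
Definition least_ge_m1 (P : int -> Prop) : \bar int :=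
  match pselect (exists n : nat, `[< P (n%:Z - 1) >]) with
  | left ex => ((ex_minn ex)%:Z - 1)%:E
  | right _ => +oo%E
  end.

Lemma least_ge_m1P (P : int -> Prop) (d : int) :
  (least_ge_m1 P <= d%:E)%E <-> exists e : int, [/\ -1 <= e, e <= d & P e].
Proof.
rewrite /least_ge_m1; case: pselect => [ex|nex].
  case: ex_minnP => m /asboolP Pm mmin; rewrite lee_fin; split=> [md|].
    by exists (m%:Z - 1); split=> //; rewrite lerBrDr addNr.
  move=> [e [e1 ed Pe]]; apply: le_trans ed.
  rewrite -lerBrDr opprK; have e0 : 0 <= e + 1 by rewrite -lerBlDr sub0r.
  rewrite -(gez0_abs e0) lez_nat; apply: mmin; apply/asboolP.
  by rewrite gez0_abs // addrK.
split=> // -[e [e1 ed Pe]]; case: nex.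
have e0 : 0 <= e + 1 by rewrite -lerBlDr sub0r.
by exists `|(e + 1)%R|%N; apply/asboolP; rewrite gez0_abs // addrK.
Qed.

Definition deg (W : FImod) : \bar int :=
  least_ge_m1 (fun d => forall S : finType, d < #|S|%:Z -> forall x : W S, x = 0).

Definition hdeg (j : nat) (V : FImod) : \bar int := deg (Hm j V).

(* A maximum of elements of {-1, 0, 1, ...} and [+oo] is their least upper bound. *)
Definition local_degree (V : FImod) : \bar int :=
  least_ge_m1 (fun d => forall j, (hdeg j V <= d%:E)%E).

Definition stable_degree (V : FImod) : \bar int :=
  least_ge_m1 (fun r => torsion (iter `|(r + 1)%R|%N derivative V)).

Inductive Poly1 : int -> int -> FImod -> Prop :=
| Poly1_base (L : int) (V : FImod) :
    (deg V <= (L - 1)%:E)%E -> Poly1 (-1) L V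
| Poly1_step (r L : int) (V : FImod) :
    0 <= r -> (hdeg 0 V <= (L - 1)%:E)%E -> Poly1 (r - 1) L (derivative V) ->
    Poly1 r L V.

(* Main.v *)
Require Import Defs.
From HB Require Import structures.
From mathcomp Require Import all_boot all_order all_algebra.
From mathcomp Require Import ring_quotient.
From mathcomp Require Import boolp constructive_ereal.
Import Order.TTheory GRing.Theory Num.Theory.
Local Open Scope ring_scope.
Local Open Scope quotient_scope.

Set Implicit Arguments.
Unset Strict Implicit.
Unset Printing Implicit Defensive.

(** The recursion defining [Poly1] splits into two equivalences, one for each of the
    invariants on the right-hand side.  For the stable degree it is immediate from
    the definition, torsion being preserved by [derivative].  For the local degree
    it says that, for [L >= 0] and any [V],
      h^max(V) <= L - 1  iff  h^0(V) <= L - 1 and h^max(derivative V) <= L - 1,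
    which is [local_degree_derivative].  At the bottom of the recursion,
    [deg V <= L - 1] iff [V] is torsion of local degree at most L - 1
    ([deg_leP_torsion]).

    Call a set S large when #|S| >= L.  If h^0(V) <= L - 1, then 0 -> V -> shift V ->
    derivative V -> 0 is exact on large sets, because the kernel of V -> shift V is
    torsion.  It should give a long exact sequence of local cohomology on large
    sets, in which H^j(shift V)_S = H^j(V)_(S + {*}).  If the H^j(V) vanish on large
    sets, so do the H^j(derivative V).  Conversely, if the latter vanish, then
    H^j(V)_S -> H^j(V)_(S + {*}) is injective on large sets; as H^j(V) is torsion, it
    vanishes on large sets ([Gam_exact_of_shift_injective]).

    The long exact sequence is replaced by one complex of injectives.  If R
    resolves V and R' resolves the derivative, then shift R resolves shift V
    ([shift_injective]), and iterated mapping cones of R -> shift R -> R' form a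
    complex T of injectives, exact on large sets ([total_exact]).  The key fact
    ([contraction], [exact_Gam_exact]) is that a complex of injectives which is
    exact on large sets is contractible there, so that its torsion part is exact
    there too.  Applied to T it relates the cohomologies of R, shift R and R', by
    elementary properties of cones; applied to a resolution of V itself it shows
    that all H^j(V) vanish on large sets when V does ([vanish_of_degree]). *)

(** * Additive maps and morphisms *)

Lemma subrACA (A : zmodType) (a b c d : A) : (a - b) - (c - d) = (a - c) - (b - d).
Proof. by rewrite !opprD addrACA. Qed.

Definition additive_of (A B : zmodType) (f : A -> B) (fB : zmod_morphism f) :
    {additive A -> B} :=
  HB.pack_for {additive A -> B} f (GRing.isZmodMorphism.Build A B f fB).

Definition mor_of (V W : FImod) (f : forall S, V S -> W S)
    (fB : forall S, zmod_morphism (f S))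
    (fN : forall S T (h : FIhom S T) x, f T (FImap V h x) = FImap W h (f S x)) :
    FImor V W :=
  @MkFImor V W (fun S => additive_of (fB S)) fN.

(** * Direct sums and torsion elements *)

Section Modules.
Variables V W : FImod.

Definition zero_mod : FImod :=
  @MkFImod (fun=> 'I_1 : zmodType) (fun S T h => \0)
    (fun S x => esym (ord1 x)) (fun S T U g f x => erefl).

Lemma zero_modE S (x : zero_mod S) : x = 0. Proof. exact: ord1. Qed.

Lemma zero_mor_fN S T (h : FIhom S T) (x : V S) : 0 = FImap W h 0.
Proof. by rewrite raddf0. Qed.

Definition zero_mor : FImor V W :=
  @MkFImor V W (fun S => \0) zero_mor_fN.

Definition sum_map S T (h : FIhom S T) (x : V S * W S) : V T * W T :=
  (FImap V h x.1, FImap W h x.2).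

Lemma sum_mapB S T (h : FIhom S T) : zmod_morphism (sum_map h).
Proof. by move=> x y; rewrite /sum_map !raddfB. Qed.

Lemma sum_map_id S x : additive_of (sum_mapB (FIid S)) x = x.
Proof. by case: x => x y; rewrite /= /sum_map !FImap_id. Qed.

Lemma sum_map_comp S T U (g : FIhom T U) (f : FIhom S T) x :
  additive_of (sum_mapB (FIcomp g f)) x =
  additive_of (sum_mapB g) (additive_of (sum_mapB f) x).
Proof. by rewrite /= /sum_map !FImap_comp. Qed.

Definition sum_mod : FImod :=
  @MkFImod (fun S => (V S * W S)%type : zmodType) (fun S T h => additive_of (sum_mapB h))
  sum_map_id sum_map_comp.

End Modules.

Lemma torsion_pair (V W : FImod) S (x : V S) (y : W S) :
  is_torsion_elt (x : V S) -> is_torsion_elt y ->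
  is_torsion_elt ((x, y) : sum_mod V W S).
Proof.
move=> [T [f fx]] [U [g gy]]; have [X [f' [g' fg]]] := FI_amalg f g.
exists X, (FIcomp f' f); rewrite /= /sum_map /=; congr pair.
  by rewrite FImap_comp fx raddf0.
by rewrite fg FImap_comp gy raddf0.
Qed.

Lemma torsion_fst (V W : FImod) S (p : sum_mod V W S) :
  is_torsion_elt p -> is_torsion_elt p.1.
Proof. by move=> [T [f /(congr1 fst) fx]]; exists T, f. Qed.

Lemma torsion_snd (V W : FImod) S (p : sum_mod V W S) :
  is_torsion_elt p -> is_torsion_elt p.2.
Proof. by move=> [T [f /(congr1 snd) fx]]; exists T, f. Qed.

Lemma torsion_mor (V W : FImod) (f : FImor V W) S (x : V S) :
  is_torsion_elt x -> is_torsion_elt (f S x).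
Proof. by move=> [T [h hx]]; exists T, h; rewrite -FImor_nat hx raddf0. Qed.

Lemma torsion0 (V : FImod) S : is_torsion_elt (0 : V S).
Proof. by exists S, (FIid S); rewrite raddf0. Qed.

Lemma torsionB (V : FImod) S (x y : V S) :
  is_torsion_elt x -> is_torsion_elt y -> is_torsion_elt (x - y).
Proof. exact: (torsion_zsub V S).2. Qed.

(** * Injective modules *)

Lemma zero_injective : injective_mod zero_mod.
Proof.
by move=> A B i _ f; exists (zero_mor B _) => S x; rewrite [RHS]zero_modE.
Qed.

Lemma sum_injective V W : injective_mod V -> injective_mod W ->
  injective_mod (sum_mod V W).
Proof.
move=> injV injW A B i moni f.
have f1B S : zmod_morphism (fun x : A S => (f S x).1) by move=> x y; rewrite raddfB.
have f2B S : zmod_morphism (fun x : A S => (f S x).2) by move=> x y; rewrite raddfB.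
have f1N S T (h : FIhom S T) (x : A S) : (f T (FImap A h x)).1 = FImap V h (f S x).1.
  by rewrite FImor_nat.
have f2N S T (h : FIhom S T) (x : A S) : (f T (FImap A h x)).2 = FImap W h (f S x).2.
  by rewrite FImor_nat.
have [g1 g1P] := injV _ _ i moni (mor_of f1B f1N).
have [g2 g2P] := injW _ _ i moni (mor_of f2B f2N).
have gB S : zmod_morphism (fun x : B S => (g1 S x, g2 S x) : sum_mod V W S).
  by move=> x y; rewrite !raddfB.
have gN S T (h : FIhom S T) (x : B S) :
  (g1 T (FImap B h x), g2 T (FImap B h x)) =
  FImap (sum_mod V W) h (g1 S x, g2 S x) by rewrite !FImor_nat.
exists (mor_of gB gN) => S x /=.
by rewrite g1P g2P /=; case: (f S x).
Qed.

(** Injectivity is about monomorphisms, but it also solves [f = g \o e] for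
    any [e] whose kernel lies in that of [f]: [f] then factors through the image
    of [e], and extends from there.  All homotopies and comparison maps below
    come from this form. *)
Lemma injective_extend (I A B : FImod) (e : FImor A B) (f : FImor A I) :
  injective_mod I -> (forall S x, e S x = 0 -> f S x = 0) ->
  exists g : FImor B I, forall S x, g S (e S x) = f S x.
Proof.
move=> injI kef.
have im S (y : submod (FIim e) S) : exists x, e S x = subg_val y.
  by have /zsubP := subgP y.
pose pre S y := projT1 (cid (im S y)).
have preP S y : e S (pre S y) = subg_val y := projT2 (cid (im S y)).
have fE S x x' : e S x = e S x' -> f S x = f S x'.
  move=> exx'; apply/eqP; rewrite -subr_eq0 -raddfB; apply/eqP/kef.
  by rewrite raddfB exx' subrr.
have f'B S : zmod_morphism (fun y => f S (pre S y)).
  by move=> y z; rewrite -raddfB; apply: fE; rewrite raddfB !preP.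
have f'N S T (h : FIhom S T) (y : submod (FIim e) S) :
    f T (pre T (FImap (submod (FIim e)) h y)) = FImap I h (f S (pre S y)).
  by rewrite -FImor_nat; apply: fE; rewrite preP FImor_nat preP.
have [|g gP] := injI _ _ (submod_incl (FIim e)) _ (mor_of f'B f'N).
  by move=> S; apply: subg_inj.
exists g => S x.
have ex : e S x \in FIim e S by apply/zsubP; exists x.
by rewrite -[e S x]/(submod_incl (FIim e) S (Subg ex)) gP /=; apply: fE; rewrite preP.
Qed.

Lemma retract_injective (I J : FImod) (i : FImor I J) (p : FImor J I) :
  (forall S x, p S (i S x) = x) -> injective_mod J -> injective_mod I.
Proof.
move=> pi injJ A B j monj f.
have [g gP] := injJ _ _ j monj (FImor_comp i f).
by exists (FImor_comp p g) => S x; rewrite /= gP /= pi.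
Qed.

(** * Shifting preserves injective modules *)

Section ShiftMor.
Variables (V W : FImod) (f : FImor V W).

Definition shift_mor : FImor (shift V) (shift W) :=
  @MkFImor (shift V) (shift W) (fun S => f (option S))
    (fun S T h x => FImor_nat f (FIoption h) x).
End ShiftMor.

Section ShiftCoind.

(** An injection [h : S + {*} -> U] is a point [c = h None] of [U] together with
    an injection of [S] into the complement of [c]; [restrict] and [adjoin] are
    the two directions of this correspondence. *)
Section Restrict.
Variables (S U : finType) (c : U) (h : FIhom (option S) U) (hc : h None = c).

Lemma restrict_neq s : h (Some s) != c.
Proof. by rewrite -hc; apply/eqP => /FIhom_inj. Qed.

Definition restrict_fun s : {x : U | x != c} := Sub (h (Some s)) (restrict_neq s).

Lemma restrict_inj : injective restrict_fun.
Proof. by move=> s t /(congr1 val) /= /FIhom_inj []. Qed.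

Definition restrict : FIhom S {x : U | x != c} := mkFIhom restrict_inj.
End Restrict.

Section Adjoin.
Variables (U : finType) (c : U).

Definition adjoin_fun (x : option {x : U | x != c}) : U :=
  if x is Some y then val y else c.

Lemma adjoin_inj : injective adjoin_fun.
Proof.
move=> [x|] [y|] //=; first by move/val_inj ->.
  by move=> xc; have := valP x; rewrite /= xc eqxx.
by move=> yc; have := valP y; rewrite /= -yc eqxx.
Qed.

Definition adjoin : FIhom (option {x : U | x != c}) U := mkFIhom adjoin_inj.

End Adjoin.

Lemma adjoin_restrict (S U : finType) (c : U) (h : FIhom (option S) U) (hc : h None = c) :
  FIcomp (adjoin c) (FIoption (restrict hc)) = h.
Proof.
apply: FIhomP => -[s|]; rewrite FIcompE !mkFIhomE //=.
by rewrite mkFIhomE.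
Qed.

Lemma restrict_comp (S T U : finType) (c : U) (h : FIhom (option T) U) (f : FIhom S T)
    (hc : h None = c) (hfc : FIcomp h (FIoption f) None = c) :
  restrict hfc = FIcomp (restrict hc) f.
Proof.
apply: FIhomP => s; rewrite FIcompE !mkFIhomE; apply: val_inj => /=.
by rewrite FIcompE mkFIhomE.
Qed.

(** By the correspondence above, the shift of T |-> Map(FIhom T n, Q/Z) is the
    product, over the points c of n, of T |-> Map(FIhom T (n - c), Q/Z), and a
    morphism to the latter is a homomorphism to Q/Z from the value at n - c.
    The proof extends these homomorphisms one by one, as for [coind] itself. *)
Lemma shift_coind_injective V : injective_mod (shift (coind V)).
Proof.
move=> A B i moni f.
pose comp n (c : 'I_n) b (a : A {x : 'I_n | x != c}) : QZ :=
  f _ a (existT _ n (adjoin c, b) : coind_index V _).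
have compB n c b : zmod_morphism (@comp n c b).
  by move=> x y; rewrite /comp raddfB.
pose ext n (c : 'I_n) b := projT1 (cid (QZ_injective (additive_of (compB n c b)) (moni _))).
have extP n (c : 'I_n) b a : ext n c b (i _ a) = comp n c b a.
  exact: projT2 (cid (QZ_injective (additive_of (compB n c b)) (moni _))) a.
pose g S (x : B S) : shift (coind V) S :=
  fun u => let: existT n (h, b) := u in
           ext n (h None) b (FImap B (restrict (erefl (h None))) x).
(* The type of [ext n (h None) b] depends on [h]; equations between points of 'I_n
   can be used once [h None] is replaced by a variable. *)
have gE S (x : B S) n (h : FIhom (option S) 'I_n) b c (hc : h None = c) :
    g S x (existT _ n (h, b)) = ext n c b (FImap B (restrict hc) x).
  by case: c / hc.
have gB S : zmod_morphism (g S).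
  by move=> x y; apply: funext => -[n [h b]] /=; rewrite !raddfB.
have gN S T (h : FIhom S T) (x : B S) :
    g T (FImap B h x) = FImap (shift (coind V)) h (g S x).
  apply: funext => -[n [k b]].
  rewrite [RHS]/= /coind_map_fun /coind_pull.
  have kc : FIcomp k (FIoption h) None = k None by rewrite FIcompE mkFIhomE.
  by rewrite (gE _ _ _ _ _ _ kc) (gE _ _ _ _ _ _ erefl) (restrict_comp erefl) FImap_comp.
exists (mor_of gB gN) => S x; apply: funext => -[n [h b]].
rewrite [LHS](gE _ _ _ _ _ _ erefl) -FImor_nat extP /comp FImor_nat /= /coind_map_fun /=.
by rewrite adjoin_restrict.
Qed.

(** An injective module is a retract of its coinduced hull, so its shift is a
    retract of an injective module. *)
Lemma shift_injective I : injective_mod I -> injective_mod (shift I).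
Proof.
move=> injI.
have [p pP] : exists p : FImor (coind I) I, forall S x, p S (coind_emb I S x) = x.
  have idN S T (h : FIhom S T) (x : I S) : FImap I h x = FImap I h x by [].
  have idB S : zmod_morphism (fun x : I S => x) by [].
  exact: injI (@coind_emb_mono I) (mor_of idB idN).
apply: (@retract_injective _ _ (shift_mor (coind_emb I)) (shift_mor p)).
  by move=> S x; apply: pP.
exact: shift_coind_injective.
Qed.

End ShiftCoind.

(** * Cochain complexes and their torsion parts *)

Record cochain := MkCochain {
  cobj :> nat -> FImod;
  cd : forall n, FImor (cobj n) (cobj n.+1);
  cdd : forall n S (x : cobj n S), cd n.+1 S (cd n S x) = 0
}.

Definition prev_obj (C : nat -> FImod) (n : nat) : FImod :=
  if n is m.+1 then C m else zero_mod.

(** The differential into degree [n]; making it total with a zero module in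
    degree -1 lets one statement cover injectivity in degree 0 and exactness in
    the other degrees. *)
Definition dprev (C : cochain) n : FImor (prev_obj C n) (C n) :=
  match n return FImor (prev_obj C n) (C n) with
  | 0 => zero_mor _ _
  | m.+1 => cd C m
  end.

Lemma dprev_cd (C : cochain) n S (x : prev_obj C n S) : cd C n S (dprev C n S x) = 0.
Proof. by case: n x => [|n] x; rewrite /= ?raddf0 ?cdd. Qed.

Definition exact (C : cochain) n (S : finType) : Prop :=
  forall x : C n S, cd C n S x = 0 -> exists y, dprev C n S y = x.

Definition Gam_boundary (C : cochain) n S (x : C n S) : Prop :=
  exists y, is_torsion_elt y /\ dprev C n S y = x.

(** Exactness at [S], in degree [n], of the complex obtained from [C] by applying
    [Gam]; phrased with elements of [C], it needs neither nested subgroups nor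
    quotients. *)
Definition Gam_exact (C : cochain) n (S : finType) : Prop :=
  forall x : C n S, is_torsion_elt x -> cd C n S x = 0 -> Gam_boundary x.

(** * Complexes of injectives exact on large sets *)

Section Truncation.
Variables (L : nat) (V : FImod).

Lemma trunc_zsub S : zsub_axiom (fun x : V S => (#|S| < L)%N -> x = 0).
Proof. by split=> // x y x0 y0 SL; rewrite x0 // y0 // subr0. Qed.

Lemma card_FIhom (S T : finType) (h : FIhom S T) : (#|S| <= #|T|)%N.
Proof. exact: leq_card (@FIhom_inj _ _ h). Qed.

Lemma trunc_map S T (h : FIhom S T) (x : V S) :
  x \in zsub (trunc_zsub S) -> FImap V h x \in zsub (trunc_zsub T).
Proof.
move=> /zsubP x0; apply/zsubP => TL; rewrite x0 ?raddf0 //.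
exact: leq_ltn_trans (card_FIhom h) TL.
Qed.

Definition trunc : FIsub V := MkFIsub trunc_map.

End Truncation.

Section Contraction.
Variables (C : cochain) (L : nat).
Hypothesis injC : forall n, injective_mod (C n).
Hypothesis exC : forall n (S : finType), (L <= #|S|)%N -> exact C n S.

(** A bounded-below exact complex of injectives is contractible.  Here exactness
    holds only on sets with at least [L] elements, but extension by zero from
    those sets is exact, so the usual induction goes through after replacing the
    source of each map to be extended by its submodule [trunc]: id - d h kills
    the cycles there, hence extends along d to the next h. *)
Lemma contraction n : exists h : FImor (C n) (prev_obj C n),
  forall (S : finType) (x : C n S), (L <= #|S|)%N -> cd C n S x = 0 ->
    dprev C n S (h S x) = x.
Proof.
elim: n => [|n [h hP]].
  by exists (zero_mor _ _) => S x LS /(exC LS)[y <-].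
pose e := FImor_comp (cd C n) (submod_incl (trunc L (C n))).
have rB S : zmod_morphism (fun x : submod (trunc L (C n)) S =>
    subg_val x - dprev C n S (h S (subg_val x))).
  move=> x y; rewrite -[subg_val (x - y)]/(subg_val x - subg_val y).
  by rewrite [h S _]raddfB [dprev C n S _]raddfB subrACA.
have rN S T (k : FIhom S T) (x : submod (trunc L (C n)) S) :
    subg_val (FImap (submod (trunc L (C n))) k x)
      - dprev C n T (h T (subg_val (FImap (submod (trunc L (C n))) k x)))
    = FImap (C n) k (subg_val x - dprev C n S (h S (subg_val x))).
  by rewrite raddfB /= !FImor_nat.
have [|g gP] := @injective_extend _ _ _ e (mor_of rB rN) (@injC n).
  move=> S x /= dx.
  have /zsubP x0 := subgP x.
  have [LS|/negP SL] := boolP (L <= #|S|)%N; first by rewrite hP // subrr.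
  by rewrite x0 ?ltnNge; [rewrite !raddf0 addr0 | apply/negP].
exists g => S z LS /(exC LS)[x <-] /=.
have xt : x \in trunc L (C n) S by apply/zsubP; rewrite ltnNge LS.
by have := gP S (Subg xt) => /= ->; rewrite raddfB dprev_cd subr0.
Qed.

(** Morphisms preserve torsion elements, so a contraction of [C] contracts the
    complex of torsion parts as well. *)
Lemma exact_Gam_exact n (S : finType) : (L <= #|S|)%N -> Gam_exact C n S.
Proof.
move=> LS x tx dx; have [h hP] := contraction n.
by exists (h S x); split; [exact: torsion_mor | exact: hP].
Qed.

End Contraction.

(** * Mapping cones *)

Record chain_map (C D : cochain) := MkChainMap {
  cm :> forall n, FImor (C n) (D n);
  cm_d : forall n S (x : C n S), cm n.+1 S (cd C n S x) = cd D n S (cm n S x)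
}.

Definition delay (C : cochain) : cochain :=
  @MkCochain (prev_obj C) (dprev C) (fun n S x => dprev_cd x).

Lemma Gam_exact_delay0 (C : cochain) S : Gam_exact (delay C) 0 S.
Proof.
move=> x _ _; exists 0; split; first exact: torsion0.
by rewrite [RHS]zero_modE.
Qed.

Section Cone.
Variables (C D : cochain) (f : chain_map C D).

(** The usual mapping cone moved by one degree (the homotopy fibre of [f]), so that
    it lives in nonnegative degrees and computes kernels in degree 0. *)
Definition cone_obj n : FImod := sum_mod (C n) (prev_obj D n).

Definition cone_d_fun n S (x : cone_obj n S) : cone_obj n.+1 S :=
  (cd C n S x.1, f n S x.1 - dprev D n S x.2).

Lemma cone_dB n S : zmod_morphism (@cone_d_fun n S).
Proof.
move=> x y; apply: injective_projections => /=; first exact: raddfB.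
by rewrite [f n S _]raddfB [dprev D n S _]raddfB subrACA.
Qed.

Lemma cone_dN n S T (h : FIhom S T) (x : cone_obj n S) :
  cone_d_fun (FImap (cone_obj n) h x) = FImap (cone_obj n.+1) h (cone_d_fun x).
Proof. by rewrite /cone_d_fun /= /sum_map /= raddfB !FImor_nat. Qed.

Definition cone_d n : FImor (cone_obj n) (cone_obj n.+1) :=
  mor_of (@cone_dB n) (@cone_dN n).

Lemma cone_dd n S (x : cone_obj n S) : cone_d n.+1 S (cone_d n S x) = 0.
Proof. by rewrite /= /cone_d_fun /= cdd raddfB cm_d dprev_cd subr0 subrr. Qed.

Definition cone : cochain := MkCochain cone_dd.

Lemma cone_injective : (forall n, injective_mod (C n)) ->
  (forall n, injective_mod (D n)) -> forall n, injective_mod (cone n).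
Proof.
move=> injC injD n; apply: sum_injective => //.
by case: n => [|n]; [exact: zero_injective | exact: injD].
Qed.

(** This lemma and the next three are the parts used below of the long exact
    sequence H^(n-1)(D) -> H^n(cone) -> H^n(C) -> H^n(D), for the complexes of
    torsion parts. *)
Lemma Gam_exact_cone n S :
  Gam_exact C n S -> Gam_exact (delay D) n S -> Gam_exact cone n S.
Proof.
move=> exC exD [x y] txy [dx fxy].
have [x' [tx' xE]] := exC x (torsion_fst txy) dx.
have ty := torsion_snd txy; rewrite /= in ty fxy.
case: n => [|n] in exC exD x y txy dx fxy x' tx' xE ty *.
  exists 0; split; first exact: torsion0.
  by rewrite /= -xE /= [y]zero_modE.
have [||y' [ty' yE]] := exD (f n S x' - y).
- by apply: torsionB => //; apply: torsion_mor.
- rewrite raddfB /=; apply/eqP; rewrite subr_eq0; apply/eqP.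
  by move: fxy => /subr0_eq <-; rewrite -xE /= cm_d.
exists (x', y'); split; first exact: torsion_pair.
rewrite /= /cone_d_fun /=; congr pair; first exact: xE.
by rewrite [dprev _ _ _ _]yE opprB addrC subrK.
Qed.

Lemma Gam_exact_target n S :
  Gam_exact C n S -> Gam_exact cone n.+1 S -> Gam_exact D n S.
Proof.
move=> exC exCone z tz dz.
have [||[x y] [txy [dx fxy]]] := exCone (0, z).
- exact: torsion_pair (torsion0 _ _) tz.
- by rewrite /= /cone_d_fun /= !raddf0 dz subr0.
have [x' [tx' xE]] := exC x (torsion_fst txy) dx.
have ty := torsion_snd txy; rewrite /= in ty fxy.
case: n => [|n] in exC exCone z tz dz x y txy dx fxy x' tx' xE ty *.
  exists 0; split; first exact: torsion0.
  by rewrite -fxy -xE /= !raddf0 addr0.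
exists (f n S x' - y); split; first by apply: torsionB => //; apply: torsion_mor.
by rewrite -fxy -xE /= raddfB cm_d.
Qed.

Lemma Gam_exact_cone_inj n S (x : C n S) (y : prev_obj D n S) : Gam_exact cone n S ->
  is_torsion_elt x -> is_torsion_elt y ->
  cd C n S x = 0 -> f n S x = dprev D n S y ->
  Gam_boundary x.
Proof.
move=> exCone tx ty dx fx.
have [||p [tp pE]] := exCone (x, y).
- exact: torsion_pair tx ty.
- by rewrite /= /cone_d_fun /= fx dx subrr.
case: n => [|n] in exCone x tx dx y ty fx p tp pE *.
  exists 0; split; first exact: torsion0.
  by case: pE => <- _.
exists p.1; split; first exact: torsion_fst.
by case: pE.
Qed.

Lemma Gam_exact_source n S :
  Gam_exact D n S -> Gam_exact cone n S -> Gam_exact C n S.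
Proof.
move=> exD exCone x tx dx.
have [||y [ty yE]] := exD (f n S x).
- exact: torsion_mor.
- by rewrite -cm_d dx raddf0.
exact: Gam_exact_cone_inj exCone tx ty dx (esym yE).
Qed.

End Cone.

Lemma cone_cycle C D (f : chain_map C D) n S (x : C n S) (y : prev_obj D n S) :
  cd (cone f) n S (x, y) = 0 -> cd C n S x = 0 /\ f n S x = dprev D n S y.
Proof.
by move=> xy0; split; [have := congr1 fst xy0 | have /subr0_eq := congr1 snd xy0].
Qed.

Lemma exact_cone C D (f : chain_map C D) n S :
  exact C n.+1 S -> exact (delay D) n.+1 S -> exact (cone f) n.+1 S.
Proof.
move=> exC exD [x y] [dx fxy]; have [x' xE] := exC x dx.
have [|y' yE] := exD (f n S x' - y).
  by rewrite raddfB /=; move: fxy; rewrite -xE cm_d => /subr0_eq ->; rewrite subrr.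
exists (x', y'); rewrite /= /cone_d_fun /=; congr pair; first exact: xE.
by rewrite [dprev _ _ _ _]yE opprB addrC subrK.
Qed.

Definition tail (C : cochain) : cochain :=
  @MkCochain (fun n => C n.+1) (fun n => cd C n.+1) (fun n S x => cdd x).

(** * Lifting a map to a chain map *)

Section Comparison.
Variables (C D : cochain).
Hypothesis exC : forall n S, exact C n.+1 S.
Hypothesis injD : forall n, injective_mod (D n.+1).

(** A component of a chain map, composed with the differential of [D], has to kill
    the cycles of [C]; this is also what the choice of the next component needs, so
    the recursion carries it along. *)
Definition liftable n (f : FImor (C n) (D n)) : Prop :=
  forall S x, cd C n S x = 0 -> cd D n S (f S x) = 0.

(** [liftable] gives the next component by injectivity; that component is
    liftable in turn because all cycles of positive degree are boundaries. *)
Lemma lift_step n (f : {f : FImor (C n) (D n) | liftable f}) :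
  exists g : {g : FImor (C n.+1) (D n.+1) | liftable g},
    forall S x, sval g S (cd C n S x) = cd D n S (sval f S x).
Proof.
case: f => f lf /=.
have [|g gP] := @injective_extend _ _ _ (cd C n) (FImor_comp (cd D n) f) (@injD n).
  exact: lf.
suff lg : liftable g by exists (exist _ g lg).
by move=> S x /exC[y <-]; rewrite gP /= cdd.
Qed.

Variables (f : FImor (C 0) (D 0)) (lf : liftable f).

Fixpoint lift_seq n : {g : FImor (C n) (D n) | liftable g} :=
  match n with
  | 0 => exist _ f lf
  | m.+1 => sval (cid (lift_step (lift_seq m)))
  end.

Definition lift_map : chain_map C D :=
  @MkChainMap C D (fun n => sval (lift_seq n))
    (fun n => svalP (cid (lift_step (lift_seq n)))).

End Comparison.

(** The component of degree 1 of a chain map to a delayed complex is a map that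
    cannot be lifted from degree 0, where the target is zero. *)
Section Delayed.
Variables (C D : cochain) (f : chain_map (tail C) D).
Hypothesis f0 : forall S x, f 0%N S (cd C 0 S x) = 0.

Definition delayed_fun n : FImor (C n) (delay D n) :=
  match n return FImor (C n) (delay D n) with
  | 0 => zero_mor _ _
  | m.+1 => f m
  end.

Lemma delayed_d n S (x : C n S) :
  delayed_fun n.+1 S (cd C n S x) = cd (delay D) n S (delayed_fun n S x).
Proof. by case: n x => [|n] x; [exact: f0 | exact: (cm_d f)]. Qed.

Definition delayed : chain_map C (delay D) := MkChainMap delayed_d.
End Delayed.

(** * A resolution built from V, its shift and its derivative *)

Section Resolutions.

Definition res_complex V (R : injres V) : cochain :=
  @MkCochain (ir_obj R) (ir_d R)
    (fun n S x => (ir_exact (ir_d R n S x)).2 (ex_intro _ x erefl)).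

Lemma res_complex_exact V (R : injres V) n S : exact (res_complex R) n.+1 S.
Proof. by move=> x /ir_exact. Qed.

Lemma ir_d_aug V (R : injres V) S (x : V S) : ir_d R 0 S (ir_aug R S x) = 0.
Proof. by apply/ir_exact0; exists x. Qed.

Lemma ir_aug_eq0 V (R : injres V) S (x : V S) : ir_aug R S x = 0 -> x = 0.
Proof. by move=> x0; apply: (@ir_aug_mono _ R S); rewrite raddf0. Qed.

Definition shift_res V (R : injres V) : injres (shift V) :=
  @MkInjres (shift V) (fun n => shift (ir_obj R n)) (shift_mor (ir_aug R))
    (fun n => shift_mor (ir_d R n)) (fun n => shift_injective (@ir_inj _ R n))
    (fun S => @ir_aug_mono _ R (option S)) (fun S x => ir_exact0 x)
    (fun n S x => ir_exact x).

Variables (V : FImod) (R : injres V) (R' : injres (derivative V)).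

Definition to_shift_res : chain_map (res_complex R) (res_complex (shift_res R)) :=
  @MkChainMap (res_complex R) (res_complex (shift_res R)) (fun n => to_shift (ir_obj R n))
    (fun n S x => esym (FImor_nat (ir_d R n) (FIsome S) x)).

Let C := cone to_shift_res.

Lemma to_shift_cone_exact n S : exact C n.+2 S.
Proof. by apply: exact_cone => x; [move/res_complex_exact | move/ir_exact]. Qed.

Let A := sum_mod (ir_obj R 0) (shift V).

(** The cycles of degree 1 of the cone of R -> shift R come from R^0 + shift V:
    the cone resolves the two-term complex V -> shift V, and its cohomology in
    degree 1 is the derivative, reached from the second summand. *)
Definition cone_cover_fun S (x : A S) : C 1%N S :=
  (ir_d R 0 S x.1, to_shift (ir_obj R 0) S x.1 + ir_aug R (option S) x.2).

Lemma cone_coverB S : zmod_morphism (@cone_cover_fun S).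
Proof.
move=> x y; apply: injective_projections => /=; first exact: raddfB.
by rewrite [FImap _ _ _]raddfB [ir_aug R _ _]raddfB opprD addrACA.
Qed.

Lemma cone_coverN S T (h : FIhom S T) (x : A S) :
  cone_cover_fun (FImap A h x) = FImap (C 1%N) h (cone_cover_fun x).
Proof.
rewrite /cone_cover_fun /= /sum_map /= raddfD !FImor_nat.
by have /= -> := to_shift_nat h x.1.
Qed.

Definition cone_cover : FImor A (C 1%N) := mor_of cone_coverB cone_coverN.

Lemma cone_cover_cycle S q : cd C 1 S (cone_cover S q) = 0.
Proof.
case: q => x v; rewrite /= /cone_d_fun /cone_cover_fun /=; congr pair.
  exact: (cdd (c := res_complex R)).
have /= dv := ir_d_aug (shift_res R) v.
by rewrite -FImor_nat raddfD dv addr0 subrr.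
Qed.

Lemma cone_cover_exact S (p : C 1%N S) :
  cd C 1 S p = 0 -> exists q, cone_cover S q = p.
Proof.
case: p => x y [dx /eqP]; rewrite subr_eq0 => /eqP fxy.
have [x' xE] := (ir_exact x).1 dx.
have [|v vE] := (@ir_exact0 _ (shift_res R) S (y - to_shift (ir_obj R 0) S x')).1.
  by rewrite raddfB -[X in X - _]fxy -xE; apply/eqP; rewrite subr_eq0 -FImor_nat.
exists (x', v); rewrite /= /cone_cover_fun /= xE; congr pair.
by rewrite -[ir_aug _ _ _]/(ir_aug (shift_res R) S v) vE addrC subrK.
Qed.

Definition cover_derivative_fun S (x : A S) : ir_obj R' 0 S :=
  ir_aug R' S (FIcoker_proj (to_shift V) S x.2).

Lemma cover_derivativeB S : zmod_morphism (@cover_derivative_fun S).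
Proof. by move=> x y; rewrite /cover_derivative_fun !raddfB. Qed.

Lemma cover_derivativeN S T (h : FIhom S T) (x : A S) :
  cover_derivative_fun (FImap A h x) = FImap (ir_obj R' 0) h (cover_derivative_fun x).
Proof. by rewrite /cover_derivative_fun -!FImor_nat. Qed.

Definition cover_derivative : FImor A (ir_obj R' 0) :=
  mor_of cover_derivativeB cover_derivativeN.

Lemma coker_proj_eq0 S (v : shift V S) :
  FIcoker_proj (to_shift V) S v = 0 <-> exists u, to_shift V S u = v.
Proof. by split=> [/quotg_eq0/zsubP | ?]; last by apply/quotg_eq0/zsubP. Qed.

Lemma coker_proj_surj S (w : derivative V S) :
  exists v, FIcoker_proj (to_shift V) S v = w.
Proof. by exists (repr w); exact: reprK. Qed.

(** This realizes the isomorphism from the degree 1 cohomology of the cone to the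
    derivative on cochains, with values in a resolution of the derivative. *)
Lemma cone_deg1_map_ex : exists f : FImor (C 1%N) (ir_obj R' 0),
  forall S q, f S (cone_cover S q) = cover_derivative S q.
Proof.
apply: injective_extend; first exact: ir_inj.
move=> S [x v] [/= /ir_exact0[u uE]]; rewrite -uE => /eqP.
rewrite addr_eq0 => /eqP ev; rewrite /cover_derivative_fun /=.
have -> : FIcoker_proj (to_shift V) S v = 0; last by rewrite raddf0.
apply/coker_proj_eq0; exists (- u); apply: (@ir_aug_mono _ R); rewrite /=.
by rewrite FImor_nat /= !raddfN ev opprK.
Qed.

Definition cone_deg1_map := sval (cid cone_deg1_map_ex).

Lemma cone_deg1_mapE S q : cone_deg1_map S (cone_cover S q) = cover_derivative S q.
Proof. exact: (svalP (cid cone_deg1_map_ex)). Qed.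

Lemma cone_deg1_map_liftable : @liftable (tail C) (res_complex R') 0 cone_deg1_map.
Proof. by move=> S p /cone_cover_exact[q <-]; rewrite cone_deg1_mapE /= ir_d_aug. Qed.

Lemma cone_deg1_map_d S x : cone_deg1_map S (cd C 0 S x) = 0.
Proof.
have -> : cd C 0 S x = cone_cover S (x.1, 0).
  by rewrite /= /cone_d_fun /cone_cover_fun /= !raddf0 !addr0.
by rewrite cone_deg1_mapE /= /cover_derivative_fun /= !raddf0.
Qed.

Definition cone_to_derivative_res : chain_map C (delay (res_complex R')) :=
  @delayed C (res_complex R')
    (lift_map (C := tail C) (D := res_complex R') (fun n S => @to_shift_cone_exact n S)
       (fun n => @ir_inj _ R' n.+1) cone_deg1_map_liftable)
    cone_deg1_map_d.

Let T := cone cone_to_derivative_res.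

Lemma total_injective n : injective_mod (T n).
Proof.
apply: cone_injective => {}n.
  apply: cone_injective => {}n; first exact: ir_inj.
  exact: (@ir_inj _ (shift_res R)).
by case: n => [|n]; [exact: zero_injective | exact: ir_inj].
Qed.

(** The cone of C -> R', where C is the cone of R -> shift R, computes the complex
    V -> shift V -> derivative V -> 0, whose only cohomology is the kernel of
    V -> shift V in degree 0; hence it is exact wherever that kernel is zero.  In
    degree 0 this kernel appears; in degrees 1 and 2 the cohomology of C is
    cancelled by that of R'; from degree 3 on both C and R' are exact. *)
Lemma total_exact S : (forall x : V S, to_shift V S x = 0 -> x = 0) ->
  forall n, exact T n S.
Proof.
move=> injV [|[|[|n]]].
- move=> [[x y] z] /cone_cycle[/cone_cycle[/ir_exact0[u uE] fx] _].
  exists 0; rewrite [z]zero_modE [y]zero_modE.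
  suff -> : x = 0 by [].
  rewrite -uE; suff -> : u = 0 by rewrite raddf0.
  by apply: injV; apply: (@ir_aug_mono _ R); rewrite raddf0 /= FImor_nat uE.
- move=> [p z] /cone_cycle[/cone_cover_exact[[x v] <-]].
  rewrite [cone_to_derivative_res _ _ _]cone_deg1_mapE => /ir_aug_eq0/coker_proj_eq0[u /= uE].
  (* The second component of (x, v) is a class that is zero in the derivative, so
     v comes from u; the image of u in R^0 is a cycle that can absorb it. *)
  exists ((x + ir_aug R S u, 0), 0).
  rewrite [z]zero_modE -uE; apply: injective_projections; last exact: zero_modE.
  rewrite /= /cone_d_fun /cone_cover_fun /=.
  by rewrite !raddfD ir_d_aug !raddf0 !addr0 FImor_nat.
- move=> [p z] /cone_cycle[/to_shift_cone_exact[q <-]].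
  rewrite cm_d => /eqP; rewrite -subr_eq0 -raddfB => /eqP/ir_exact0[w wE].
  have [v vE] := coker_proj_surj w.
  (* q and z differ in R'^0 by a class w of the derivative; a lift v of w gives a
     cycle of the cone by which q is corrected. *)
  exists (q - cone_cover S (0, v), 0).
  apply: injective_projections; rewrite /=.
    rewrite -[LHS]/(cd C 1 S (q - cone_cover S (0, v))) raddfB cone_cover_cycle.
    by rewrite subr0.
  rewrite subr0 -[cone_cover_fun _]/(cone_cover S (0, v)) raddfB cone_deg1_mapE /=.
  by rewrite /cover_derivative_fun /= vE wE opprB addrC subrK.
- apply: exact_cone; first exact: to_shift_cone_exact.
  exact: res_complex_exact.
Qed.

End Resolutions.

(** * Torsion and shifts *)

Lemma torsion_of_shift (V : FImod) (S : finType) (x : V (option S)) :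
  is_torsion_elt (x : shift V S) -> is_torsion_elt x.
Proof. by move=> [T [f fx]]; exists (option T), (FIoption f). Qed.

Section ToNone.
Variables (T : finType) (t : T).
Definition to_None (u : T) : option T := if u == t then None else Some u.

Lemma to_None_inj : injective to_None.
Proof.
by move=> u v; rewrite /to_None; do 2![case: eqP => [->|_] //]; case.
Qed.
End ToNone.

(** The maps of [shift V] fix the added point.  If some [g] kills an element, so
    does [g] followed by an injection sending [g None] to the added point, and this
    composite fixes it. *)
Lemma torsion_to_shift (V : FImod) (S : finType) (x : V (option S)) :
  is_torsion_elt x -> is_torsion_elt (x : shift V S).
Proof.
move=> [T [g gx]]; exists T, (FIcomp g (FIsome S)).
have -> : FImap (shift V) (FIcomp g (FIsome S)) x =
    FImap V (mkFIhom (@to_None_inj T (g None))) (FImap V g x); last by rewrite gx raddf0.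
rewrite -FImap_comp /=; congr (FImap V _ x).
apply: FIhomP => -[s|]; rewrite FIcompE !mkFIhomE /to_None /= ?eqxx //.
by rewrite FIcompE mkFIhomE (inj_eq (@FIhom_inj _ _ g)).
Qed.

Section FromOption.
Variables (S T : finType) (h : FIhom S T) (t : T).
Hypothesis ht : t \notin codom h.

Definition from_option_fun (s : option S) : T := if s is Some s' then h s' else t.

Lemma from_option_inj : injective from_option_fun.
Proof.
move=> [s|] [s'|] //=; first by move/FIhom_inj->.
  by move=> hs; move: ht; rewrite -hs codom_f.
by move=> hs; move: ht; rewrite hs codom_f.
Qed.

Definition from_option : FIhom (option S) T := mkFIhom from_option_inj.

Lemma from_option_some : FIcomp from_option (FIsome S) = h.
Proof. by apply: FIhomP => s; rewrite FIcompE !mkFIhomE. Qed.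
End FromOption.

Lemma FImap_card_eq0 (V : FImod) (S T : finType) (h : FIhom S T) (x : V S) :
  #|T| = #|S| -> FImap V h x = 0 -> x = 0.
Proof.
move=> TS hx; have [|g hK gK] := inj_card_bij (@FIhom_inj _ _ h); first by rewrite TS.
have -> : x = FImap V (mkFIhom (can_inj gK)) (FImap V h x); last by rewrite hx raddf0.
rewrite -FImap_comp -[LHS]FImap_id; congr (FImap V _ x).
by apply: FIhomP => s; rewrite FIcompE FIidE mkFIhomE hK.
Qed.

(** Local cohomology is torsion: a class on [S] is killed by some S -> T.  Such an
    injection is a bijection or factors through S -> S + {*}, so if adding a point
    is injective on classes over large sets, induction on #|T| - #|S| kills the
    class itself. *)
Lemma Gam_exact_of_shift_injective (C : cochain) n L :
  (forall (S : finType) (x : C n S), (L <= #|S|)%N -> is_torsion_elt x -> cd C n S x = 0 ->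
     Gam_boundary (FImap (C n) (FIsome S) x) -> Gam_boundary x) ->
  forall S : finType, (L <= #|S|)%N -> Gam_exact C n S.
Proof.
move=> inj S LS x tx dx; have [T [h hx]] := tx.
have [k kE] : exists k, #|T| = (k + #|S|)%N.
  by exists (#|T| - #|S|)%N; rewrite subnK //; apply: card_FIhom h.
elim: k => [|k IH] in S LS x tx dx h hx kE *.
  exists 0; split; first exact: torsion0.
  by rewrite raddf0 (FImap_card_eq0 kE hx).
have [t ht] : exists t, t \notin codom h.
  apply/existsP; rewrite -negb_forall; apply/forallP => hall.
  have : (#|T| <= #|codom h|)%N by apply/subset_leq_card/subsetP => t _; apply: hall.
  by rewrite card_codom ?kE; [rewrite addSn ltnNge leq_addl | exact: FIhom_inj].
have oS : #|{: option S}| = #|S|.+1 by rewrite card_option.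
apply: inj => //.
apply: (IH _ _ _ _ _ (from_option ht)).
- by rewrite oS leqW.
- exact: torsion_of_shift (torsion_mor (to_shift (C n)) tx).
- by rewrite FImor_nat dx raddf0.
- by rewrite -FImap_comp from_option_some.
- by rewrite oS kE addnS addSn.
Qed.

(** * Vanishing of local cohomology on large sets *)

Section ShiftComplex.
Variables (V : FImod) (R : injres V).

Lemma Gam_exact_shift n (S : finType) :
  Gam_exact (res_complex R) n (option S) -> Gam_exact (res_complex (shift_res R)) n S.
Proof.
move=> exR x /torsion_of_shift tx dx; have [y [ty yE]] := exR x tx dx.
case: n => [|n] in exR x tx dx y ty yE *.
  by exists 0; split; first exact: torsion0.
by exists y; split; first exact: torsion_to_shift.
Qed.

Lemma Gam_boundary_shift n (S : finType) (x : res_complex R n (option S)) :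
  Gam_boundary x -> Gam_boundary (x : res_complex (shift_res R) n S).
Proof.
move=> [y [ty yE]]; case: n => [|n] in x y ty yE *.
  by exists 0; split; first exact: torsion0.
by exists y; split; first exact: torsion_to_shift.
Qed.

(** [Gam] is left exact: the torsion cycles of degree 0 are the torsion elements
    of V. *)
Lemma Gam_exact0P S :
  Gam_exact (res_complex R) 0 S <-> forall x : V S, is_torsion_elt x -> x = 0.
Proof.
split=> [ex x tx|ex x tx /ir_exact0[v vE]].
  have [||y [_ /= yE]] := ex (ir_aug R S x).
  - exact: torsion_mor.
  - exact: ir_d_aug.
  - exact: ir_aug_eq0 (esym yE).
exists 0; split; first exact: torsion0.
rewrite -vE (ex v) ?raddf0 //; have [T [f fx]] := tx; exists T, f.
by apply: (@ir_aug_eq0 _ R); rewrite FImor_nat vE.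
Qed.

End ShiftComplex.

Definition vanish_from (L : nat) V (R : injres V) : Prop :=
  forall S : finType, (L <= #|S|)%N -> forall n, Gam_exact (res_complex R) n S.

Section Derivative.
Variables (V : FImod) (R : injres V) (R' : injres (derivative V)) (L : nat).

(** A point in the kernel of V -> shift V is torsion, so it is zero on large sets
    once H^0 vanishes there; the total complex is then exact on large sets, hence
    so is its torsion part. *)
Lemma total_Gam_exact (S : finType) n :
  (forall S : finType, (L <= #|S|)%N -> Gam_exact (res_complex R) 0 S) -> (L <= #|S|)%N ->
  Gam_exact (cone (cone_to_derivative_res R R')) n S.
Proof.
move=> ex0; apply: exact_Gam_exact => {S}[m|m S LS]; first exact: total_injective.
apply: total_exact => x x0.
by apply: (Gam_exact0P R S).1 (ex0 S LS) _ _; exists (option S), (FIsome S).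
Qed.

(** The torsion parts of R, shift R and of the total complex are exact at [S], so
    that of R' is exact as well: this is the long exact sequence through cones.
    The cohomology of the shift at [S] is that of V at S + {*}. *)
Lemma vanish_derivative : vanish_from L R -> vanish_from L R'.
Proof.
move=> vR S LS n.
have exR k : Gam_exact (res_complex R) k S by apply: vR.
have exSR k : Gam_exact (delay (res_complex (shift_res R))) k S.
  case: k => [|k]; first exact: Gam_exact_delay0.
  by apply: Gam_exact_shift; apply: vR; rewrite card_option leqW.
have exC k : Gam_exact (cone (to_shift_res R)) k S by apply: Gam_exact_cone.
have exT : Gam_exact (cone (cone_to_derivative_res R R')) n.+2 S.
  by apply: total_Gam_exact => // T LT; apply: vR.
exact: Gam_exact_target (exC n.+1) exT.
Qed.

(** Since the torsion parts of the total complex and of R' are exact at [S], so is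
    that of the cone of R -> shift R, which makes H^n(V)_S -> H^n(V)_(S + {*})
    injective in all degrees. *)
Lemma vanish_of_derivative :
  (forall S : finType, (L <= #|S|)%N -> Gam_exact (res_complex R) 0 S) ->
  vanish_from L R' -> vanish_from L R.
Proof.
move=> ex0 vR' S LS n; move: S LS; apply: Gam_exact_of_shift_injective => S x LS tx dx.
move=> /Gam_boundary_shift[y [ty yE]].
have exC : Gam_exact (cone (to_shift_res R)) n S.
  apply: (@Gam_exact_source _ _ (cone_to_derivative_res R R')); last exact: total_Gam_exact.
  case: n {x tx dx y ty yE} => [|n]; [exact: Gam_exact_delay0 | exact: vR'].
exact: (Gam_exact_cone_inj exC tx ty dx (esym yE)).
Qed.

End Derivative.

(** If V is zero on large sets, its resolutions are exact there, in degree 0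
    included. *)
Lemma vanish_of_degree V (R : injres V) L :
  (forall S : finType, (L <= #|S|)%N -> forall x : V S, x = 0) -> vanish_from L R.
Proof.
move=> V0 S LS n; apply: exact_Gam_exact LS => [m|]; first exact: ir_inj.
move=> [|m] T LT; last exact: res_complex_exact.
by move=> x /ir_exact0[v <-]; exists 0; rewrite (V0 T LT v) !raddf0.
Qed.

Lemma Gam_exactP V (R : injres V) n S :
  Gam_exact (res_complex R) n S <-> forall x : cohom_Gam R n S, x = 0.
Proof.
split=> [ex x|ex x tx dx].
  rewrite -[x]reprK; case: (repr x) => -[z tz] dz; apply/quotg_eq0/zsubP => /=.
  have /zsubP/(congr1 val) /= dz0 := dz; have /zsubP tz' := tz.
  have [y [ty yE]] := ex z tz' dz0.
  case: n => [|n] in ex x z tz dz dz0 tz' y ty yE *.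
    by apply/zsubP/val_inj; rewrite /= -yE.
  have ty' : y \in torsion_part _ S by apply/zsubP.
  by apply/zsubP; exists (Subg ty'); apply: val_inj.
have tx' : x \in torsion_part _ S by apply/zsubP.
have dx' : Subg tx' \in FIker (Gam_map (ir_d R n)) S by apply/zsubP/val_inj.
have /quotg_eq0/zsubP /= := ex (\pi_(Quotient.quot _) (Subg dx')).
case: n => [|n] in ex x tx dx tx' dx' *.
  move=> /zsubP/(congr1 val) /= ->; exists 0; split=> //; exact: torsion0.
move=> /zsubP[y /(congr1 val) /= yE]; exists (subg_val y); split=> //.
by have /zsubP := subgP y.
Qed.

(** * Degrees *)

Lemma deg_leP (L : nat) (W : FImod) :
  (deg W <= (L%:Z - 1)%:E)%E <->
  forall S : finType, (L <= #|S|)%N -> forall x : W S, x = 0.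
Proof.
rewrite least_ge_m1P; split=> [[e [_ eL W0]] S LS|W0].
  by apply: W0; apply: le_lt_trans eL _; rewrite ltrBlDr ltzD1 lez_nat.
exists (L%:Z - 1); split=> // [|S]; first by rewrite lerBrDr addNr.
by rewrite ltrBlDr ltzD1 lez_nat => LS; apply: W0.
Qed.

Lemma hdeg_leP (L : nat) (V : FImod) j :
  (hdeg j V <= (L%:Z - 1)%:E)%E <->
  forall S : finType, (L <= #|S|)%N -> Gam_exact (res_complex (std_res V)) j S.
Proof. by rewrite deg_leP; split=> H S LS; apply/Gam_exactP/H. Qed.

Lemma local_degree_leP (L : nat) (V : FImod) :
  (local_degree V <= (L%:Z - 1)%:E)%E <-> forall j, (hdeg j V <= (L%:Z - 1)%:E)%E.
Proof.
rewrite least_ge_m1P; split=> [[e [_ eL He]] j|H].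
  by apply: le_trans (He j) _; rewrite lee_fin.
by exists (L%:Z - 1); split=> //; rewrite lerBrDr addNr.
Qed.

Lemma torsion_derivative V : torsion V -> torsion (derivative V).
Proof.
move=> tV S x; have [v <-] := coker_proj_surj x.
exact: torsion_mor (torsion_to_shift (tV _ v)).
Qed.

Lemma stable_degree_leP (n : nat) (V : FImod) :
  (stable_degree V <= (n%:Z - 1)%:E)%E <-> torsion (iter n derivative V).
Proof.
rewrite least_ge_m1P; split=> [[e [e1 en te]]|tn]; last first.
  by exists (n%:Z - 1); split=> //; rewrite ?subrK // lerBrDr addNr.
have e0 : 0 <= e + 1 by rewrite -lerBlDr sub0r.
have kn : (`|(e + 1)%R| <= n)%N by rewrite -lez_nat gez0_abs // -lerBrDr.
rewrite -(subnK kn) iterD; elim: (n - _)%N => //= k; exact: torsion_derivative.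
Qed.

Lemma Poly1_baseP (L : int) V : Poly1 (-1) L V <-> (deg V <= (L - 1)%:E)%E.
Proof.
split=> [H|]; last exact: Poly1_base.
by inversion H.
Qed.

Lemma Poly1_stepP (n : nat) (L : int) V : Poly1 n%:Z L V <->
  (hdeg 0 V <= (L - 1)%:E)%E /\ Poly1 (n%:Z - 1) L (derivative V).
Proof.
split=> [H|[h0 dV]]; last exact: Poly1_step.
by inversion H.
Qed.

(** The recursion satisfied by the local degree is the one that defines [Poly1]. *)
Lemma local_degree_derivative (L : nat) V :
  (local_degree V <= (L%:Z - 1)%:E)%E <->
  (hdeg 0 V <= (L%:Z - 1)%:E)%E /\ (local_degree (derivative V) <= (L%:Z - 1)%:E)%E.
Proof.
rewrite !local_degree_leP; split=> [H|[/hdeg_leP h0 H]].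
  split=> // j; apply/hdeg_leP => S LS.
  apply: (vanish_derivative (R := std_res V)) LS _ => T LT k.
  exact: (hdeg_leP _ _ _).1 (H k) T LT.
move=> j; apply/hdeg_leP => S LS.
apply: (vanish_of_derivative (R' := std_res _)) LS _ => // T LT k.
exact: (hdeg_leP _ _ _).1 (H k) T LT.
Qed.

(** A torsion module is its own H^0, so its degree is bounded by the local degree.
    Conversely a module of finite degree is torsion, and [vanish_of_degree] bounds
    its local cohomology. *)
Lemma deg_leP_torsion (L : nat) V : (deg V <= (L%:Z - 1)%:E)%E <->
  torsion V /\ (local_degree V <= (L%:Z - 1)%:E)%E.
Proof.
rewrite deg_leP local_degree_leP; split=> [V0|[tV /(_ 0%N)/hdeg_leP V0] S LS x].
  split=> [S x|j]; last by apply/hdeg_leP => S LS; apply: vanish_of_degree LS _.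
  (* L additional points make any set large. *)
  have inl_inj : injective (@inl S 'I_L) by move=> s t [].
  exists (S + 'I_L)%type, (mkFIhom inl_inj); apply: V0.
  by rewrite card_sum card_ord leq_addl.
exact: (Gam_exact0P _ _).1 (V0 S LS) x (tV S x).
Qed.

Lemma Poly1P (n L : nat) V : Poly1 (n%:Z - 1) L%:Z V <->
  torsion (iter n derivative V) /\ (local_degree V <= (L%:Z - 1)%:E)%E.
Proof.
elim: n V => [|n IH] V; first by rewrite sub0r Poly1_baseP deg_leP_torsion.
rewrite intS [1 + _ - 1]addrC addKr Poly1_stepP IH (local_degree_derivative L V) iterSr.
by split=> [[h0 [tV hV]]|[tV [h0 hV]]]; do 2?split.
Qed.

Theorem theoremA (r L : int) (hr : -1 <= r) (hL : 0 <= L) (V : FImod) :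
  Poly1 r L V <->
  (stable_degree V <= r%:E)%E /\ (local_degree V <= (L - 1)%:E)%E.
Proof.
have [n ->] : exists n : nat, r = n%:Z - 1.
  by exists `|(r + 1)%R|%N; rewrite gez0_abs ?addrK // -lerBlDr sub0r.
case: L hL => // L _.
by rewrite Poly1P stable_degree_leP.
Qed.
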